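(* Let $(P,A,\lambda)$ be a marked poset with $\lambda$ integer-valued, and let $H$ be a bounded strongly planar embedding of $(P,A,\lambda)$ with associated flow network $G=G_{(P,A,\lambda)}$. Define $\Gamma$ on $\mathcal{O}(P,A)_\lambda$ by $\Gamma(x)=f\in\mathbb{R}^{E(G)}$, where for the edge $e$ of $G$ crossing the covering relation $p\lessdot q$ of $\widehat P$ we set $f(e)=x_q-x_p$ (with the convention $x_{\hat0}=\lambda(\hat0)$, $x_{\hat1}=\lambda(\hat1)$). Then $\Gamma$ is an integral equivalence from the marked order polytope $\mathcal{O}(P,A)_\lambda$ onto the flow polytope $\mathcal{F}_{G}$.
   Context: A marked poset $(P,A,\lambda)$ consists of a finite poset $P$, a subposet $A\subseteq P$ containing all minimal and all maximal elements of $P$, and an order-preserving map $\lambda:A\to\mathbb{R}$; its marked order polytope is $\mathcal{O}(P,A)_\lambda=\{x\in\mathbb{R}^P: x_p\le x_q\text{ for }p<q,\ x_a=\lambda(a)\text{ for }a\in A\}$. Let $\widehat P=P\sqcup\{\hat0,\hat1\}$ with $\hat0<p<\hat1$ for all $p\in P$, $\widehat A=A\cup\{\hat0,\hat1\}$, and extend $\lambda$ by $\lambda(\hat0)=\min_{a\in A}\lambda(a)$, $\lambda(\hat1)=\max_{a\in A}\lambda(a)$; elements of $\widehat A$ are called marked. $P$ is strongly planar if the Hasse diagram of $\widehat P$ has a planar drawing in which $y$-coordinates strictly increase along every covering relation from the smaller to the larger element. A bounded embedding $H$ is such a drawing together with two additional edges joining $\hat0$ and $\hat1$, one drawn to the left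 of everything else and one to the right, regarded as a plane graph. For a bounded face $F$ of $H$, $\min F$ and $\max F$ are the least and greatest elements of $\widehat P$ on its boundary; removing them splits the boundary into two paths, and the left (resp. right) boundary of $F$ is the left (resp. right) path together with $\min F$ and $\max F$. $H$ is a bounded strongly planar embedding of $(P,A,\lambda)$ if for every bounded face $F$ whose left boundary contains an element of $\widehat A$, both $\min F$ and $\max F$ lie in $\widehat A$. Let $F_L$ (resp. $F_R$) be the bounded face whose left (resp. right) boundary is the additional left (resp. right) edge. Each Hasse edge $p\lessdot q$ of $\widehat P$ lies on the left boundary of exactly one bounded face $R(e)$ and on the right boundary of exactly one bounded face $L(e)$. The flow network $G_{(P,A,\lambda)}$: (i) for each bounded face $F\ne F_R$ a vertex $v_F$, with netflow $0$ if the left boundary of $F$ contains no element of $\widehat A$ and netflow $-(\lambda(\max F)-\lambda(\min F))$ otherwise; (ii) for each bounded face $F\ne F_L$ whose left boundary contains elements of $\widehat A$, say $r_1>r_2>\cdots>r_g$ (so $r_1=\max F$, $r_g=\min F$), vertices $s^F_m$, $m\in[g-1]$, with netflow $\lambda(r_m)-\lambda(r_{m+1})$; (iii) for each Hasse edge $e=(p\lessdot q)$ of $\widehat P$ one directed edge, said to cross $p\lessdot q$, with head $v_{L(e)}$ and tail $v_{R(e)}$ if the left boundary of $R(e)$ contains no element of $\widehat A$, and otherwise tail $s^{R(e)}_m$ where $e$ lies on the left boundary of $R(e)$ between $r_{m+1}$ and $r_m$. For a directed graph $G$ with netflow $a:V(G)\to\mathbb{R}$, the flow polytope is $\mathcal{F}_G=\{f\in\mathbb{R}_{\ge0}^{E(G)}:\sum_{e\text{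 out of }v}f(e)-\sum_{e\text{ into }v}f(e)=a(v)\ \forall v\}$. Two integral polytopes $\mathcal P\subseteq\mathbb{R}^d$, $\mathcal Q\subseteq\mathbb{R}^m$ are integrally equivalent via an affine map $\varphi:\mathbb{R}^d\to\mathbb{R}^m$ if $\varphi$ restricts to a bijection $\mathcal P\to\mathcal Q$ and to a bijection $\mathbb{Z}^d\cap\mathrm{aff}(\mathcal P)\to\mathbb{Z}^m\cap\mathrm{aff}(\mathcal Q)$. *)

(* Defs.v *)
From HB Require Import structures.
From mathcomp Require Import all_boot all_order all_algebra.
From mathcomp Require Import all_classical all_reals all_analysis.

Set Implicit Arguments.
Unset Strict Implicit.
Unset Printing Implicit Defensive.

Import Order.TTheory GRing.Theory Num.Theory numFieldNormedType.Exports.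
Local Open Scope classical_set_scope.
Local Open Scope ring_scope.

Section MarkedPoset.
Variables (R : realType) (d : Order.disp_t) (P : finPOrderType d).

Definition hatP := (bool + P)%type.
Definition hbot : hatP := inl false.
Definition htop : hatP := inl true.

Definition hle (x y : hatP) : bool :=
  match x, y with
  | inl false, _ => true
  | _, inl true => true
  | inr p, inr q => (p <= q)%O
  | _, _ => false
  end.
Definition hlt (x y : hatP) : bool := (x != y) && hle x y.

Definition hcover (x y : hatP) : bool :=
  hlt x y && ~~ [exists z : hatP, hlt x z && hlt z y].

Definition HEdge := {e : hatP * hatP | hcover e.1 e.2}.
Definition etail (e : HEdge) : hatP := (val e).1.
Definition ehead (e : HEdge) : hatP := (val e).2.

Definition hmarked (A : {set P}) (x : hatP) : bool :=
  match x with inl _ => true | inr p => p \in A end.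

(* lambda(0^) = min_A lambda, lambda(1^) = max_A lambda
   (A is nonempty as soon as P is; for P empty we use the value 0) *)
Definition lam_min (A : {set P}) (lam : P -> R) : R :=
  if [pick a in A] is Some a0 then \big[Num.min/lam a0]_(a in A) lam a else 0.
Definition lam_max (A : {set P}) (lam : P -> R) : R :=
  if [pick a in A] is Some a0 then \big[Num.max/lam a0]_(a in A) lam a else 0.

Definition xhat (A : {set P}) (lam : P -> R) (x : P -> R) (v : hatP) : R :=
  match v with
  | inl false => lam_min A lam
  | inl true => lam_max A lam
  | inr p => x p
  end.
Definition lamhat (A : {set P}) (lam : P -> R) : hatP -> R := xhat A lam lam.

Definition marked_poset (A : {set P}) (lam : P -> R) : Prop :=
  (forall p : P, (forall q : P, ~~ (q < p)%O) -> p \in A) /\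
  (forall p : P, (forall q : P, ~~ (p < q)%O) -> p \in A) /\
  (forall a b : P, a \in A -> b \in A -> (a <= b)%O -> lam a <= lam b).

Definition marked_order_polytope (A : {set P}) (lam : P -> R) : set (P -> R) :=
  [set x | (forall p q : P, (p < q)%O -> x p <= x q) /\
           (forall a : P, a \in A -> x a = lam a)].

Local Notation pt := (R * R)%type.

Definition upcurve (g : R -> pt) (a b : pt) : Prop :=
  {within `[0, 1], continuous g} /\ g 0 = a /\ g 1 = b /\
  (forall s t : R, 0 <= s -> s < t -> t <= 1 -> (g s).2 < (g t).2).

Definition curve_img (g : R -> pt) : set pt := g @` `[0, 1].

Definition drawing_pts (pos : hatP -> pt) (c : HEdge -> R -> pt) : set pt :=
  range pos `|` \bigcup_(e in setT) curve_img (c e).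

Definition strongly_planar_drawing (pos : hatP -> pt) (c : HEdge -> R -> pt) : Prop :=
  injective pos /\
  (forall e : HEdge, upcurve (c e) (pos (etail e)) (pos (ehead e))) /\
  (forall (e e' : HEdge) (s t : R), e != e' -> 0 <= s <= 1 -> 0 <= t <= 1 ->
      c e s = c e' t -> (s = 0 \/ s = 1) /\ (t = 0 \/ t = 1)) /\
  (forall (e : HEdge) (v : hatP) (t : R), 0 < t < 1 -> c e t <> pos v).

Definition bounded_drawing (pos : hatP -> pt) (c : HEdge -> R -> pt)
    (cL cR : R -> pt) : Prop :=
  strongly_planar_drawing pos c /\
  upcurve cL (pos hbot) (pos htop) /\ upcurve cR (pos hbot) (pos htop) /\
  (forall t : R, 0 < t < 1 -> forall z : pt,
      (drawing_pts pos c `|` curve_img cR) z -> z.2 = (cL t).2 -> (cL t).1 < z.1) /\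
  (forall t : R, 0 < t < 1 -> forall z : pt,
      (drawing_pts pos c `|` curve_img cL) z -> z.2 = (cR t).2 -> z.1 < (cR t).1).

Section Faces.
Variables (pos : hatP -> pt) (c : HEdge -> R -> pt) (cL cR : R -> pt).

Definition complementH : set pt :=
  ~` (drawing_pts pos c `|` curve_img cL `|` curve_img cR).

Definition bounded_face (F : set pt) : Prop :=
  (exists z, complementH z /\ F = connected_component complementH z) /\
  (exists M : R, forall z, F z -> `|z.1| <= M /\ `|z.2| <= M).

Definition right_of (g : R -> pt) (F : set pt) : Prop :=
  exists t : R, 0 < t < 1 /\ exists2 eps : R, 0 < eps &
    forall s : R, 0 < s < eps -> F ((g t).1 + s, (g t).2).
Definition left_of (g : R -> pt) (F : set pt) : Prop :=
  exists t : R, 0 < t < 1 /\ exists2 eps : R, 0 < eps &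
    forall s : R, 0 < s < eps -> F ((g t).1 - s, (g t).2).

Definition on_left_bd (F : set pt) (e : HEdge) : Prop := right_of (c e) F.
Definition on_right_bd (F : set pt) (e : HEdge) : Prop := left_of (c e) F.

Definition is_FL (F : set pt) : Prop := bounded_face F /\ right_of cL F.
Definition is_FR (F : set pt) : Prop := bounded_face F /\ left_of cR F.

Definition left_bd_elt (F : set pt) (v : hatP) : Prop :=
  (exists e : HEdge, on_left_bd F e /\ (v = etail e \/ v = ehead e)) \/
  (right_of cL F /\ (v = hbot \/ v = htop)).

Definition on_bd (F : set pt) (v : hatP) : Prop := closure F (pos v).
Definition is_minF (F : set pt) (m : hatP) : Prop :=
  on_bd F m /\ forall v, on_bd F v -> hle m v.
Definition is_maxF (F : set pt) (m : hatP) : Prop :=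
  on_bd F m /\ forall v, on_bd F v -> hle v m.

Definition left_bd_marked (A : {set P}) (F : set pt) : Prop :=
  exists v, left_bd_elt F v /\ hmarked A v.

(* r' < r are consecutive marked elements on the left boundary of F,
   i.e. (r, r') = (r_m, r_{m+1}) for some m *)
Definition consec_marked (A : {set P}) (F : set pt) (r r' : hatP) : Prop :=
  left_bd_elt F r /\ hmarked A r /\ left_bd_elt F r' /\ hmarked A r' /\
  hlt r' r /\
  ~ (exists v, left_bd_elt F v /\ hmarked A v /\ hlt r' v /\ hlt v r).

Definition bounded_sp_embedding (A : {set P}) : Prop :=
  bounded_drawing pos c cL cR /\
  forall F, bounded_face F -> left_bd_marked A F ->
    (exists m, is_minF F m /\ hmarked A m) /\
    (exists M, is_maxF F M /\ hmarked A M).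

(* The flow polytope F_G of the network G_(P,A,lambda).  Edges of G are
   indexed by the Hasse edges of P^; conservation is written out at each
   vertex v_F (F bounded, F <> F_R) and s^F_m (F bounded, F <> F_L, left
   boundary of F containing marked elements), the vertex s^F_m being indexed
   by the pair of consecutive marked elements (r_m, r_{m+1}). *)
Definition flow_polytope (A : {set P}) (lam : P -> R) : set (HEdge -> R) :=
  [set f | (forall e, 0 <= f e) /\
    (forall F, bounded_face F -> ~ is_FR F -> ~ left_bd_marked A F ->
       \sum_(e : HEdge | `[< on_left_bd F e >]) f e
       - \sum_(e : HEdge | `[< on_right_bd F e >]) f e = 0) /\
    (* v_F, left boundary with marked elements: no outgoing edges *)
    (forall F, bounded_face F -> ~ is_FR F -> left_bd_marked A F ->
       forall m M, is_minF F m -> is_maxF F M ->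
       0 - \sum_(e : HEdge | `[< on_right_bd F e >]) f e
         = - (lamhat A lam M - lamhat A lam m)) /\
    (forall F, bounded_face F -> ~ is_FL F -> left_bd_marked A F ->
       forall r r', consec_marked A F r r' ->
       \sum_(e : HEdge | `[< on_left_bd F e >] && hle r' (etail e) && hle (ehead e) r) f e
         = lamhat A lam r - lamhat A lam r')].

End Faces.

Definition Gamma (A : {set P}) (lam : P -> R) (x : P -> R) : HEdge -> R :=
  fun e => xhat A lam x (ehead e) - xhat A lam x (etail e).

End MarkedPoset.

Section IntEquiv.
Variable R : realType.

Definition int_point {I : Type} (x : I -> R) : Prop :=
  forall i, exists z : int, x i = z%:~R.

Definition aff_hull {I : Type} (S : set (I -> R)) : set (I -> R) :=
  [set y | exists (n : nat) (cf : 'I_n -> R) (xs : 'I_n -> I -> R),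
     (forall i, S (xs i)) /\ \sum_(i < n) cf i = 1 /\
     y = (fun k => \sum_(i < n) cf i * xs i k)].

Definition affine_map {I J : Type} (phi : (I -> R) -> (J -> R)) : Prop :=
  forall (n : nat) (cf : 'I_n -> R) (xs : 'I_n -> I -> R),
    \sum_(i < n) cf i = 1 ->
    phi (fun k => \sum_(i < n) cf i * xs i k) =
    (fun j => \sum_(i < n) cf i * phi (xs i) j).

Definition bij_on {X Y : Type} (S : set X) (T : set Y) (phi : X -> Y) : Prop :=
  (forall x, S x -> T (phi x)) /\
  (forall x y, S x -> S y -> phi x = phi y -> x = y) /\
  (forall y, T y -> exists2 x, S x & phi x = y).

Definition integrally_equivalent {I J : Type}
    (S : set (I -> R)) (T : set (J -> R)) (phi : (I -> R) -> (J -> R)) : Prop :=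
  affine_map phi /\ bij_on S T phi /\
  bij_on (aff_hull S `&` int_point) (aff_hull T `&` int_point) phi.

End IntEquiv.

(* Main.v *)
(* The edges of the bounded embedding are graphs x = g(y) over intervals of
   heights.  Fix a point of the complement, at a height carrying no vertex.  Among
   the bottom-to-top walks passing to its left there is a greatest one: continue the
   nearest edge in both directions, taking the rightmost edge at every vertex.
   Symmetrically there is a least walk passing to its right.  Every edge lies on some bottom-to-top walk,
   so no edge runs strictly between these two.  They meet first at a vertex M above
   and at a vertex m below the point, and the region enclosed by them is its face.
   Hence the left and the right boundaries of a bounded face are walks from min F
   to max F, and the flow conditions for Gamma x are telescoping sums.

   Conversely, a flow f has the same sum along both sides of every face other than
   F_L and F_R.  By induction along the order, its sum along a walk from 0^ to p
   does not depend on the walk: two incoming edges of p are compared through the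
   faces between them, all of which have maximum p.  These sums define x.  They agree
   with lambda on a marked p because p lies on the left boundary of the face to the
   right of an incoming edge of p, whose minimum is marked and lower. *)

(* No Jordan curve theorem is used. The open region between two walks is connected, and it is
   relatively closed in the complement of the drawing because its boundary consists of edges; hence
   it is a whole component. Conversely, a point of a bounded component must lie in the strip between
   the two additional edges, since otherwise a horizontal ray escapes to infinity without meeting an
   edge. Inside the strip these edges guarantee a nearest edge on either side, which is why they are
   treated on a par with the Hasse edges.

   Heights that carry a vertex are avoided by moving the point a little inside the complement; at
   the remaining heights edges are linearly ordered from left to right.

   The axioms of a drawing are stable under reflection in height and in abscissa, so only one of
   each pair of mirror statements needs a direct argument.

   Affine hulls need no description: [Gamma] is injective on all functions on [P], and integrality
   passes both ways because values are recovered by adding flows to an integer starting value at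
   0^. *)
Require Import Defs.
From HB Require Import structures.
From mathcomp Require Import all_boot all_order all_algebra.
From mathcomp Require Import all_classical all_reals all_analysis.
From mathcomp Require Import lra.

Set Implicit Arguments.
Unset Strict Implicit.
Unset Printing Implicit Defensive.

Import Order.TTheory GRing.Theory Num.Theory numFieldNormedType.Exports.
Local Open Scope classical_set_scope.
Local Open Scope ring_scope.

(** * Walks in a directed multigraph *)

Section Walk.
Variables (V K : eqType) (src dst : K -> V).

Fixpoint walk (u : V) (s : seq K) (w : V) : bool :=
  if s is k :: s' then (src k == u) && walk (dst k) s' w else u == w.

Lemma walk_cat u s t w v : walk u s v -> walk v t w -> walk u (s ++ t) w.
Proof.
elim: s u => [|k s IH] u /=; first by move/eqP->.
by case/andP=> -> /IH{}IH /IH.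
Qed.

Lemma walk_catE u s t w :
  walk u (s ++ t) w -> exists2 v, walk u s v & walk v t w.
Proof.
elim: s u => [|k s IH] u /=; first by exists u.
by case/andP=> -> /IH[v sv vt]; exists v.
Qed.

Lemma walk1 k : walk (src k) [:: k] (dst k).
Proof. by rewrite /= !eqxx. Qed.

Lemma walk_consE u k s w : walk u (k :: s) w -> u = src k /\ walk (dst k) s w.
Proof. by move=> /= /andP[/eqP<-]. Qed.

Lemma walk_rconsE u s k w : walk u (rcons s k) w -> walk u s (src k) /\ dst k = w.
Proof.
by rewrite -cats1 => /walk_catE[v us] /= /andP[/eqP-> /eqP].
Qed.

Lemma walk_mem u s w k : walk u s w -> k \in s -> exists s1 s2,
  [/\ s = s1 ++ k :: s2, walk u s1 (src k) & walk (dst k) s2 w].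
Proof.
move=> usw ks; move: usw; case/splitPr: ks => s1 s2 /walk_catE[v us1].
by move=> /walk_consE[vE s2w]; exists s1, s2; rewrite -vE.
Qed.

Lemma walk_split u s w k v : walk u s w -> k \in s -> v = src k \/ v = dst k ->
  exists s1 s2, [/\ s = s1 ++ s2, walk u s1 v & walk v s2 w].
Proof.
move=> usw /(walk_mem usw)[s1 [s2 [-> us1 s2w]]] [->|->].
  by exists s1, (k :: s2); rewrite /= eqxx.
exists (rcons s1 k), s2; rewrite cat_rcons; split=> //.
by rewrite -cats1; apply: walk_cat us1 (walk1 k).
Qed.

(** Serves both sides of the proof: with [h] an abscissa it evaluates the curve of a walk at its
    ends, with [h] a potential it evaluates a flow along the walk. *)
Lemma walk_telescope (Z : zmodType) (h : V -> Z) u s w : walk u s w ->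
  \sum_(k <- s) (h (dst k) - h (src k)) = h w - h u.
Proof.
elim: s u => [|k s IH] u /=; first by move/eqP->; rewrite big_nil subrr.
by case/andP=> /eqP<- /IH; rewrite big_cons => ->; rewrite addrC addrA subrK.
Qed.

End Walk.

Lemma walk_rev (V K : eqType) (src dst : K -> V) u s w :
  walk src dst u s w -> walk dst src w (rev s) u.
Proof.
elim: s u => [|k s IH] u; first by rewrite /= eq_sym.
move=> /walk_consE[-> /IH]; rewrite rev_cons -cats1 => /walk_cat; apply.
exact: walk1.
Qed.

(** * Planar drawings whose edges are graphs over the height axis *)

Section Drawing.
Variables (R : realType) (V K : finType).

(* [g k] parametrizes the edge [k] by height; it is extended to a continuous
   function on [R], constant below the source and above the target. *)
Record drawing (X Y : V -> R) (src dst : K -> V) (g : K -> R -> R)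
    (bot top : V) : Prop := Drawing {
  d_up : forall k, Y (src k) < Y (dst k);
  d_cont : forall k, continuous (g k);
  d_lo : forall k y, y <= Y (src k) -> g k y = X (src k);
  d_hi : forall k y, Y (dst k) <= y -> g k y = X (dst k);
  d_inj : forall u v, X u = X v -> Y u = Y v -> u = v;
  d_nc : forall k k' y, k != k' ->
    Y (src k) <= y -> y <= Y (dst k) -> Y (src k') <= y -> y <= Y (dst k') ->
    g k y = g k' y -> y = Y (src k) \/ y = Y (dst k);
  d_nv : forall k v, Y (src k) < Y v -> Y v < Y (dst k) -> g k (Y v) <> X v;
  d_out : forall v, v != top -> exists k, src k = v;
  d_in : forall v, v != bot -> exists k, dst k = v }.

(** The abscissa at height [y] of the concatenated edges of [s]. Since each [g k] is constant
    outside its range, an edge entirely above [y] contributes 0 and an edge entirely below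
    contributes its full displacement. Being a finite sum, the formula is continuous without any
    gluing. *)
Definition gwalk (X : V -> R) (src : K -> V) (g : K -> R -> R) u s (y : R) :=
  X u + \sum_(k <- s) (g k y - X (src k)).

(** Turning the drawing upside down exchanges sources with targets and [bot] with [top]; statements
    about the part above a point thus give those about the part below. *)
Lemma drawing_flipY X Y src dst g bot top : drawing X Y src dst g bot top ->
  drawing X (fun v => - Y v) dst src (fun k y => g k (- y)) top bot.
Proof.
case=> up co lo hi ij nc nv ou ii; split=> //.
- by move=> k; rewrite ltrN2.
- move=> k y; apply: (@continuous_comp _ _ _ (fun y => - y) (g k)).
    exact: continuousN.
  exact: co.
- by move=> k y h; rewrite hi// lerNr.
- by move=> k y h; rewrite lo// lerNl.
- by move=> u v ? /oppr_inj; apply: ij.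
- move=> k k' y kk a b c d e.
  by have [||||h|h] := nc k k' (- y) kk _ _ _ _ e; lra.
- by move=> k v; rewrite !ltrN2 opprK => a b; apply: nv.
Qed.

Lemma drawing_flipX X Y src dst g bot top : drawing X Y src dst g bot top ->
  drawing (fun v => - X v) Y src dst (fun k y => - g k y) bot top.
Proof.
case=> up co lo hi ij nc nv ou ii; split=> //.
- by move=> k y; apply: continuousN; apply: co.
- by move=> k y h; rewrite lo.
- by move=> k y h; rewrite hi.
- by move=> u v /oppr_inj; apply: ij.
- by move=> k k' y kk a b c d /oppr_inj; apply: nc.
- by move=> k v a b /oppr_inj; apply: nv.
Qed.

Lemma gwalk_flipX X src g u s y :
  gwalk (fun v => - X v) src (fun k y => - g k y) u s y = - gwalk X src g u s y.
Proof.
rewrite /gwalk opprD -sumrN; congr (_ + _).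
by apply: eq_bigr => k _; rewrite opprD.
Qed.

(** Reversal moves the base point of the formula from [u] to [w]; the telescoping sum of [X] along
    [s] makes up the difference. *)
Lemma gwalk_flipY X src dst g u s w y : walk src dst u s w ->
  gwalk X dst (fun k y => g k (- y)) w (rev s) (- y) = gwalk X src g u s y.
Proof.
move=> usw; rewrite /gwalk (perm_big s) ?perm_rev//=.
have := walk_telescope X usw.
have -> : \sum_(k <- s) (g k (- - y) - X (dst k)) =
  \sum_(k <- s) (g k y - X (src k)) - \sum_(k <- s) (X (dst k) - X (src k)).
  by rewrite -sumrB; apply: eq_bigr => k _; rewrite opprK opprB addrA subrK.
by move=> ->; lra.
Qed.

Section Basic.
Variables (X Y : V -> R) (src dst : K -> V) (g : K -> R -> R) (bot top : V).
Hypothesis D : drawing X Y src dst g bot top.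
Local Notation walk := (walk src dst).
Local Notation gw := (gwalk X src g).

Lemma walk_le u s w : walk u s w -> Y u <= Y w.
Proof.
elim: s u => [|k s IH] u /=; first by move/eqP->.
by case/andP=> /eqP<- /IH; apply: le_trans (ltW (d_up D k)).
Qed.

Lemma walk_lt u s w k : walk u s w -> k \in s -> Y u < Y w.
Proof.
case: s => //= k' s /andP[/eqP<- /walk_le] h _.
exact: lt_le_trans (d_up D k') h.
Qed.

Lemma walk_mem_le u s w k : walk u s w -> k \in s ->
  Y u <= Y (src k) /\ Y (dst k) <= Y w.
Proof.
by move=> h /(walk_mem h)[s1 [s2 [_ /walk_le ? /walk_le]]].
Qed.

Lemma walk_uniq u s w : walk u s w -> uniq s.
Proof.
elim: s u => [|k s IH] u //= /andP[_ h]; rewrite (IH _ h) andbT.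
apply/negP => /(walk_mem_le h)[].
by rewrite leNgt (d_up D).
Qed.

Lemma gwalk_cat u s t v y : walk u s v ->
  gw u (s ++ t) y = gw u s y + gw v t y - X v.
Proof. by move=> _; rewrite /gwalk big_cat /=; lra. Qed.

Lemma gwalk_lo u s w y : walk u s w -> y <= Y u -> gw u s y = X u.
Proof.
move=> h yu; rewrite /gwalk big_seq big1 ?addr0// => k ks.
have [h1 _] := walk_mem_le h ks.
by rewrite (d_lo D) ?subrr// (le_trans yu).
Qed.

Lemma gwalk_hi u s w y : walk u s w -> Y w <= y -> gw u s y = X w.
Proof.
move=> h wy; rewrite /gwalk big_seq.
rewrite (eq_bigr (fun k => X (dst k) - X (src k))).
  by rewrite -big_seq (walk_telescope _ h) addrC subrK.
move=> k ks; have [_ h1] := walk_mem_le h ks.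
by rewrite (d_hi D)// (le_trans _ wy).
Qed.

Lemma gwalk_on u s w k y : walk u s w -> k \in s ->
  Y (src k) <= y -> y <= Y (dst k) -> gw u s y = g k y.
Proof.
move=> h /(walk_mem h)[s1 [s2 [-> h1 h2]]] ay yb.
rewrite (gwalk_cat _ _ h1) (gwalk_hi h1 ay).
rewrite -cat1s (gwalk_cat _ _ (walk1 _ _ k)) (gwalk_lo h2 yb).
by rewrite /gwalk big_seq1; lra.
Qed.

(** At the height of a vertex of the walk this half-open choice returns the edge leaving the vertex;
    the variant [gwalk_at'] returns the edge entering it. *)
Lemma gwalk_at u s w y : walk u s w -> Y u <= y -> y < Y w ->
  exists k, [/\ k \in s, Y (src k) <= y & y < Y (dst k)].
Proof.
elim: s u => [|k s IH] u /=; first by move/eqP-> => h /(le_lt_trans h); rewrite ltxx.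
case/andP=> /eqP<- h uy yw; have [yk|ky] := ltP y (Y (dst k)).
  by exists k; rewrite inE eqxx.
by have [k' [ks a b]] := IH _ h ky yw; exists k'; rewrite inE ks orbT.
Qed.

Lemma gwalk_at' u s w y : walk u s w -> Y u < y -> y <= Y w ->
  exists k, [/\ k \in s, Y (src k) < y & y <= Y (dst k)].
Proof.
elim: s u => [|k s IH] u /=; first by move/eqP-> => /lt_le_trans h/h; rewrite ltxx.
case/andP=> /eqP<- h uy yw; have [yk|ky] := leP y (Y (dst k)).
  by exists k; rewrite inE eqxx.
by have [k' [ks a b]] := IH _ h ky yw; exists k'; rewrite inE ks orbT.
Qed.

Lemma gwalk_continuous u s : continuous (gw u s).
Proof.
have -> : gw u s = fun y => X u + \sum_(k <- s) (g k y - X (src k)) by [].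
elim: s => [|k s IH] y.
  under eq_fun do rewrite big_nil; exact: cst_continuous.
under eq_fun do rewrite big_cons addrCA.
apply: continuousD (IH y); apply: continuousB; first exact: (d_cont D).
exact: cst_continuous.
Qed.

End Basic.
End Drawing.

(** * Comparing walks: last and first meeting points *)

(** The point is the supremum of the closed set where [f1 <= f2]. A strict inequality there would,
    by the intermediate value theorem, produce a later meeting. *)
Lemma continuous_last_meet (R : realType) (f1 f2 : R -> R) a b :
  continuous f1 -> continuous f2 -> a <= b -> f1 a <= f2 a -> f2 b < f1 b ->
  exists c, [/\ a <= c, c < b, f1 c = f2 c &
    forall y, c < y -> y <= b -> f2 y < f1 y].
Proof.
move=> c1 c2 ab fa fb.
pose S := [set y | a <= y /\ y <= b] `&` [set y | 0 <= f2 y - f1 y].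
have Sa : S a by split; [split|rewrite /= subr_ge0].
have Sub : has_sup S by split; [exists a|exists b => y [[]]].
have cS : closed S.
  apply: closedI.
    have -> : [set y | a <= y /\ y <= b] = [set` `[a, b]].
      by apply/seteqP; split=> y /=; rewrite in_itv /= => /andP.
    exact: interval_closed.
  apply: (@closed_comp _ _ (fun y => f2 y - f1 y) [set y | 0 <= y]).
    by move=> y _; apply: continuousB; [exact: c2|exact: c1].
  exact: closed_ge.
have : S (sup S) by by rewrite [X in X _](closure_id S).1//; apply: closure_sup; case: Sub.
set c := sup S => -[[ac cb] /=]; rewrite subr_ge0 => fc.
have cb' : c < b.
  by rewrite lt_neqAle cb andbT; apply: contraTneq fc => ->; rewrite -ltNge.
have after y : c < y -> y <= b -> f2 y < f1 y.
  move=> cy yb; rewrite ltNge; apply/negP => h; move: (cy); apply/negP; rewrite -leNgt.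
  apply: ub_le_sup; first by case: Sub.
  by split; [split=> //; lra|rewrite /= subr_ge0].
exists c; split=> //; apply/eqP; rewrite eq_le fc /= leNgt; apply/negP => fc'.
have cf : continuous (fun y => f1 y - f2 y).
  by move=> y; apply: continuousB; [exact: c1|exact: c2].
have [||e] := @IVT R (fun y => f1 y - f2 y) c b 0 cb.
- exact: continuous_subspaceT.
- by rewrite ge_min le_max; apply/andP; split; apply/orP; [left|right]; lra.
rewrite in_itv /= => /andP[ce eb] fe.
have ne : c != e by apply: contraTneq fc' => ->; lra.
have := after e; rewrite lt_neqAle ne ce => /(_ isT eb); lra.
Qed.

Lemma continuous_first_meet (R : realType) (f1 f2 : R -> R) a b :
  continuous f1 -> continuous f2 -> a <= b -> f1 a < f2 a -> f2 b <= f1 b ->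
  exists c, [/\ a < c, c <= b, f1 c = f2 c &
    forall y, a <= y -> y < c -> f1 y < f2 y].
Proof.
move=> c1 c2 ab fa fb.
have cN (f : R -> R) : continuous f -> continuous (fun y => f (- y)).
  by move=> cf y; apply: (@continuous_comp _ _ _ (fun y => - y) f);
    [exact: continuousN|exact: cf].
have [|||c [h1 h2 h3 h4]] := continuous_last_meet (a := - b) (b := - a) (cN _ c2) (cN _ c1).
- by rewrite lerN2.
- by rewrite opprK.
- by rewrite opprK.
exists (- c); split=> //; [lra|lra|].
by move=> y ay yc; rewrite -(opprK y); apply: h4; lra.
Qed.

Definition rightmost (R : realType) (V K : Type) (Y : V -> R) (src dst : K -> V)
    (g : K -> R -> R) (j : K) : Prop :=
  forall k y, src k = src j -> Y (src j) < y -> y < Y (dst k) -> y < Y (dst j) ->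
    g k y <= g j y.

Section Up.
Variables (R : realType) (V K : finType).
Variables (X Y : V -> R) (src dst : K -> V) (g : K -> R -> R) (bot top : V).
Hypothesis D : drawing X Y src dst g bot top.
Local Notation walk := (walk src dst).
Local Notation gw := (gwalk X src g).
Local Notation rightmost := (rightmost Y src dst g).

(** A change of order would force a meeting at a height interior to both edges, which [d_nc]
    excludes. *)
Lemma edge_order_const k k' y y' : k != k' ->
  Y (src k) < y -> y < Y (dst k) -> Y (src k') < y -> y < Y (dst k') ->
  Y (src k) < y' -> y' < Y (dst k) -> Y (src k') < y' -> y' < Y (dst k') ->
  g k y < g k' y -> g k y' < g k' y'.
Proof.
move=> kk h1 h2 h3 h4 h5 h6 h7 h8 lt; rewrite ltNge; apply/negP => le.
suff [c [c1 c2 c3 c4 c5]] : exists c, [/\ Y (src k) < c, c < Y (dst k),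
    Y (src k') < c, c < Y (dst k') & g k c = g k' c].
  by case: (d_nc D kk (ltW c1) (ltW c2) (ltW c3) (ltW c4) c5) => E;
    rewrite E ltxx in c1 c2.
have [yy|yy] := leP y y'.
  have [c [? ? ? _]] := continuous_first_meet (d_cont D (k := k))
    (d_cont D (k := k')) yy lt le.
  by exists c; split=> //; lra.
have [c [? ? ? _]] := continuous_last_meet (d_cont D (k := k'))
  (d_cont D (k := k)) (ltW yy) le lt.
by exists c; split=> //; lra.
Qed.

Lemma exists_rightmost v : v != top -> exists2 j, src j = v & rightmost j.
Proof.
move=> /(d_out D)[k0 /eqP k0v].
(* [km] is the outgoing edge with the lowest target. Halfway up to that target, at height [h], every
   edge leaving [v] is present, so the rightmost one can be read off there. *)
case: (@arg_minP _ _ _ k0 (fun k => src k == v) (fun k => Y (dst k)) k0v) => km /eqP kmv kmin.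
pose h := (Y v + Y (dst km)) / 2.
have ltm : Y v < Y (dst km) by rewrite -kmv (d_up D).
case: (@arg_maxP _ _ _ k0 (fun k => src k == v) (fun k => g k h) k0v) => j /eqP jv jmax.
exists j => // k y kj y1 y2 y3; have [->//|jk] := eqVneq k j.
rewrite leNgt; apply/negP => lt.
have hk i : src i = v -> Y (src i) < h /\ h < Y (dst i).
  move=> iv; have : Y (dst km) <= Y (dst i) by apply: kmin; rewrite iv.
  by rewrite iv /h; split; lra.
have kv : src k = v by rewrite kj.
have [a b] := hk _ jv; have [a' b'] := hk _ kv.
have : g k h <= g j h by apply: jmax; rewrite kv.
rewrite leNgt => /negP; apply.
rewrite eq_sym in jk.
by apply: (edge_order_const jk) lt => //; rewrite ?kj.
Qed.

Lemma rightmost_walk u : exists2 s, walk u s top & forall j, j \in s -> rightmost j.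
Proof.
have [n] := ubnP #|[pred v | Y u < Y v]|; elim: n u => // n IH u cu.
have [->|ut] := eqVneq u top; first by exists [::] => /=.
have [j ju jr] := exists_rightmost ut.
have [|s sw sr] := IH (dst j).
  rewrite -ltnS; apply: leq_trans cu; rewrite ltnS; apply: proper_card.
  have lt : Y u < Y (dst j) by rewrite -ju (d_up D).
  apply/properP; split; first by apply/fintype.subsetP => v; rewrite !inE; apply: lt_trans.
  by exists (dst j); rewrite !inE ?ltxx.
exists (j :: s); first by rewrite /= ju eqxx.
by move=> i; rewrite inE => /predU1P[->//|/sr].
Qed.

(** At the last meeting before [s'] gets ahead, the two walks continue along different edges, so
    they leave a common vertex, and there [s] took the rightmost edge. Rightmost choices are
    demanded only from height [y0] upwards, so that [s] may be arbitrary below. *)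
Lemma walk_dominates u s u' s' y0 y : walk u s top -> walk u' s' top ->
  Y u <= y0 -> Y u' <= y0 -> y0 <= y ->
  (forall j, j \in s -> y0 <= Y (src j) -> rightmost j) ->
  gw u' s' y0 <= gw u s y0 -> gw u' s' y <= gw u s y.
Proof.
move=> sw sw' uy uy' yy rm le; rewrite leNgt; apply/negP => lt.
have [ty|yt] := leP (Y top) y.
  by move: lt; rewrite (gwalk_hi D sw ty) (gwalk_hi D sw' ty) ltxx.
have [c [c1 c2 c3 c4]] := continuous_last_meet (gwalk_continuous D (u := u') (s := s'))
  (gwalk_continuous D (u := u) (s := s)) yy le lt.
have [||j [js j1 j2]] := gwalk_at (Y := Y) (y := c) sw; [lra|lra|].
have [||k [ks k1 k2]] := gwalk_at (Y := Y) (y := c) sw'; [lra|lra|].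
(* Up to height [e] the walks are still on [j] and [k], so that just above the meeting point
   comparing walks means comparing these two edges. *)
pose e := Num.min y (Num.min (Y (dst j)) (Y (dst k))).
have ce : c < e by rewrite !lt_min c2 j2 k2.
have [ey ej ek] : [/\ e <= y, e <= Y (dst j) & e <= Y (dst k)].
  by rewrite /e !ge_min !lexx !orbT.
pose y1 := (c + e) / 2.
have : g j y1 < g k y1.
  rewrite -(gwalk_on D (u := u) (w := top) sw js) -?(gwalk_on D sw' ks) /y1; try lra.
  by apply: c4; lra.
rewrite ltNge => /negP; apply.
rewrite (gwalk_on D sw js j1 (ltW j2)) (gwalk_on D sw' ks k1 (ltW k2)) in c3.
have [->//|kj] := eqVneq k j.
have kc : c = Y (src k).
  by have [//|E] := d_nc D kj k1 (ltW k2) j1 (ltW j2) c3; move: k2; rewrite -E ltxx.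
have jc : c = Y (src j).
  rewrite eq_sym in kj.
  by have [//|E] := d_nc D kj j1 (ltW j2) k1 (ltW k2) (esym c3); move: j2; rewrite -E ltxx.
have E : src k = src j.
  by apply: (d_inj D); rewrite -?kc -?jc// -(d_lo D (k := k) (y := c)) -?kc// c3 (d_lo D) -?jc.
apply: (rm j js) => //; rewrite /y1; lra.
Qed.

(** The walks agree at [top], so there is a first meeting point. The edges arriving at it are
    distinct, because the walks are strictly ordered just below; distinct edges meet only at ends,
    so the point is a vertex. *)
Lemma walks_meet_up u1 s1 u2 s2 y0 : walk u1 s1 top -> walk u2 s2 top ->
  Y u1 <= y0 -> Y u2 <= y0 -> gw u1 s1 y0 < gw u2 s2 y0 ->
  exists M a1 b1 a2 b2,
    [/\ s1 = a1 ++ b1 /\ s2 = a2 ++ b2, walk u1 a1 M /\ walk M b1 top,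
        walk u2 a2 M /\ walk M b2 top, y0 < Y M &
        forall y, y0 <= y -> y < Y M -> gw u1 a1 y < gw u2 a2 y].
Proof.
move=> w1 w2 y1 y2 lt.
have yt : y0 < Y top.
  rewrite ltNge; apply/negP => ty.
  by move: lt; rewrite (gwalk_hi D w1 ty) (gwalk_hi D w2 ty) ltxx.
have [|c [c1 c2 c3 c4]] := continuous_first_meet (gwalk_continuous D (u := u1) (s := s1))
  (gwalk_continuous D (u := u2) (s := s2)) (ltW yt) lt.
  by rewrite (gwalk_hi D w1) ?(gwalk_hi D w2).
have [||j [js j1 j2]] := gwalk_at' (Y := Y) (y := c) w1; [lra|lra|].
have [||k [ks k1 k2]] := gwalk_at' (Y := Y) (y := c) w2; [lra|lra|].
pose e := Num.max y0 (Num.max (Y (src j)) (Y (src k))).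
have ec : e < c by rewrite !gt_max c1 j1 k1.
have [ey ej ek] : [/\ y0 <= e, Y (src j) <= e & Y (src k) <= e].
  by rewrite /e !le_max !lexx !orbT.
have jk : j != k.
  apply/eqP => E; pose y := (e + c) / 2.
  have : gw u1 s1 y < gw u2 s2 y by apply: c4; rewrite /y; lra.
  rewrite (gwalk_on D w1 js) ?(gwalk_on D w2 ks) /y; try lra.
  by rewrite E ltxx.
rewrite (gwalk_on D w1 js (ltW j1) j2) (gwalk_on D w2 ks (ltW k1) k2) in c3.
have jc : c = Y (dst j).
  by have [E|//] := d_nc D jk (ltW j1) j2 (ltW k1) k2 c3; move: j1; rewrite -E ltxx.
have kc : c = Y (dst k).
  rewrite eq_sym in jk.
  by have [E|//] := d_nc D jk (ltW k1) k2 (ltW j1) j2 (esym c3); move: k1; rewrite -E ltxx.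
have E : dst k = dst j.
  by apply: (d_inj D); rewrite -?kc -?jc// -(d_hi D (k := k) (y := c)) -?kc// -c3 (d_hi D) -?jc.
have [a1 [b1 [s1E a1w b1w]]] := walk_split w1 js (or_intror erefl).
have [a2 [b2 [s2E a2w b2w]]] := walk_split w2 ks (or_intror erefl).
rewrite E in a2w b2w.
exists (dst j), a1, b1, a2, b2; split=> //; first by rewrite -jc.
move=> y yy; rewrite -jc => yc; have := c4 y yy yc.
have yj : y <= Y (dst j) by rewrite -jc ltW.
rewrite s1E s2E (gwalk_cat _ _ _ _ a1w) (gwalk_cat _ _ _ _ a2w).
by rewrite (gwalk_lo D b1w yj) (gwalk_lo D b2w yj); lra.
Qed.

End Up.

(** * Cells: the regions enclosed by two extremal walks *)

(* [cell_out] keeps an edge on one side of the region at all heights, so that the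
   side can be tested at any single height. *)
Record cell (R : realType) (V K : finType) (X Y : V -> R) (src dst : K -> V)
    (g : K -> R -> R) (m M : V) (l r : seq K) : Prop := Cell {
  cell_l : walk src dst m l M;
  cell_r : walk src dst m r M;
  cell_lt : Y m < Y M;
  cell_in : forall y, Y m < y -> y < Y M -> gwalk X src g m l y < gwalk X src g m r y;
  cell_out : forall k,
    (forall y, Y m <= y -> y <= Y M -> Y (src k) <= y -> y <= Y (dst k) ->
      g k y <= gwalk X src g m l y) \/
    (forall y, Y m <= y -> y <= Y M -> Y (src k) <= y -> y <= Y (dst k) ->
      gwalk X src g m r y <= g k y) }.

(** The walk runs through [k0], takes rightmost outgoing edges above it and rightmost incoming edges
    below it; the latter are the rightmost edges of the drawing turned upside down. Domination is
    then applied upwards and downwards from [y0]. *)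
Lemma left_walk (R : realType) (V K : finType) (X Y : V -> R) (src dst : K -> V)
    (g : K -> R -> R) (bot top : V) (D : drawing X Y src dst g bot top) k0 y0 :
  Y (src k0) < y0 -> y0 < Y (dst k0) -> exists s,
  [/\ walk src dst bot s top, k0 \in s & forall s' y, walk src dst bot s' top ->
      gwalk X src g bot s' y0 <= g k0 y0 -> gwalk X src g bot s' y <= gwalk X src g bot s y].
Proof.
move=> a b.
have [t1 w1 r1] := rightmost_walk D (dst k0).
have [t0 w0 r0] := rightmost_walk (drawing_flipY D) (src k0).
have w0' := walk_rev w0.
set s := rev t0 ++ k0 :: t1.
have sw : walk src dst bot s top by apply: walk_cat w0' _; rewrite /= eqxx.
have ks : k0 \in s by rewrite mem_cat inE eqxx orbT.
have E := gwalk_on D sw ks (ltW a) (ltW b).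
exists s; split=> // s' y w'; rewrite -E => le.
have bot_le : Y bot <= y0 by have [h1 h2] := walk_mem_le D sw ks; lra.
have top_le : y0 <= Y top by have [h1 h2] := walk_mem_le D sw ks; lra.
have [yy|yy] := leP y0 y.
  apply: (walk_dominates D sw w' bot_le bot_le yy _ le) => j.
  rewrite mem_cat inE => /or3P[js|/eqP->|/r1//] h.
    by have [_] := walk_mem_le D w0' js; have := d_up D j; lra.
  by lra.
rewrite -(gwalk_flipY X g y sw) -(gwalk_flipY X g y w').
apply: (walk_dominates (drawing_flipY D) (walk_rev sw) (walk_rev w') (y0 := - y0)).
- by rewrite lerN2.
- by rewrite lerN2.
- by rewrite lerN2 ltW.
- move=> j; rewrite mem_rev mem_cat inE mem_rev => /or3P[/r0//|/eqP->|js] h.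
    by lra.
  by have [] := walk_mem_le D w1 js; have := d_up D j; lra.
- by rewrite (gwalk_flipY X g y0 sw) (gwalk_flipY X g y0 w').
Qed.

Section Cells.
Variables (R : realType) (V K : finType).
Variables (X Y : V -> R) (src dst : K -> V) (g : K -> R -> R) (bot top : V).
Hypothesis D : drawing X Y src dst g bot top.
Local Notation walk := (walk src dst).
Local Notation gw := (gwalk X src g).

Lemma right_walk k0 y0 : Y (src k0) < y0 -> y0 < Y (dst k0) -> exists s,
  [/\ walk bot s top, k0 \in s & forall s' y, walk bot s' top ->
      g k0 y0 <= gw bot s' y0 -> gw bot s y <= gw bot s' y].
Proof.
move=> a b; have [s [sw ks sP]] := left_walk (drawing_flipX D) a b.
exists s; split=> // s' y w' le.
by have := sP s' y w'; rewrite !gwalk_flipX !lerN2; apply.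
Qed.

Lemma walk_through k : exists2 s, walk bot s top & k \in s.
Proof.
have lt := d_up D k.
have [||s [sw ks _]] := @left_walk _ _ _ _ _ _ _ _ _ _ D k ((Y (src k) + Y (dst k)) / 2); try lra.
by exists s.
Qed.

Lemma walks_meet_down u1 s1 u2 s2 y0 : walk bot s1 u1 -> walk bot s2 u2 ->
  y0 <= Y u1 -> y0 <= Y u2 -> gw bot s1 y0 < gw bot s2 y0 ->
  exists m a1 b1 a2 b2,
    [/\ s1 = a1 ++ b1 /\ s2 = a2 ++ b2, walk bot a1 m /\ walk m b1 u1,
        walk bot a2 m /\ walk m b2 u2, Y m < y0 &
        forall y, Y m < y -> y <= y0 -> gw m b1 y < gw m b2 y].
Proof.
move=> w1 w2 y1 y2.
rewrite -(gwalk_flipY X g y0 w1) -(gwalk_flipY X g y0 w2) => lt.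
have [||m [b1 [a1 [b2 [a2 [[e1 e2] [wb1 wa1] [wb2 wa2] ym h]]]]]] :=
    walks_meet_up (drawing_flipY D) (walk_rev w1) (walk_rev w2) _ _ lt.
- by rewrite lerN2.
- by rewrite lerN2.
have {}wa1 := walk_rev wa1; have {}wb1 := walk_rev wb1.
have {}wa2 := walk_rev wa2; have {}wb2 := walk_rev wb2.
exists m, (rev a1), (rev b1), (rev a2), (rev b2); split=> //.
- by rewrite -!rev_cat -e1 -e2 !revK.
- by rewrite -ltrN2.
- move=> y my yy; rewrite -(gwalk_flipY X g y wb1) -(gwalk_flipY X g y wb2) !revK.
  by apply: h; rewrite ?lerN2 ?ltrN2.
Qed.

Lemma cell_exists k0 k1 x0 y0 : (forall v, Y v != y0) ->
  Y (src k0) < y0 -> y0 < Y (dst k0) -> Y (src k1) < y0 -> y0 < Y (dst k1) ->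
  g k0 y0 < x0 -> x0 < g k1 y0 ->
  (forall k, Y (src k) < y0 -> y0 < Y (dst k) -> g k y0 <= g k0 y0 \/ g k1 y0 <= g k y0) ->
  exists m M l r, [/\ cell X Y src dst g m M l r, k0 \in l, k1 \in r & Y m < y0 /\ y0 < Y M].
Proof.
move=> gen a0 b0 a1 b1 x0l x0r nb.
have [s0 [w0 k0s s0P]] := left_walk D a0 b0.
have [s1 [w1 k1s s1P]] := right_walk a1 b1.
have bot_le : Y bot <= y0 by have [h1 h2] := walk_mem_le D w0 k0s; lra.
have top_gt : y0 < Y top by have [h1 h2] := walk_mem_le D w0 k0s; lra.
have E0 := gwalk_on D w0 k0s (ltW a0) (ltW b0).
have E1 := gwalk_on D w1 k1s (ltW a1) (ltW b1).
(* As [y0] is no vertex height, a walk crosses it in the interior of an edge. By [nb] that edge is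
   on one side of the gap between [k0] and [k1], and extremality of [s0] or [s1] spreads this to all
   heights. *)
have side s : walk bot s top -> (forall y, gw bot s y <= gw bot s0 y) \/
    (forall y, gw bot s1 y <= gw bot s y).
  move=> sw; have [k [ks h1 h2]] := gwalk_at sw bot_le top_gt.
  have h1' : Y (src k) < y0 by rewrite lt_neqAle gen.
  have Ek := gwalk_on D sw ks h1 (ltW h2).
  have [le|le] := nb k h1' h2.
    by left=> y; apply: s0P; rewrite ?Ek.
  by right=> y; apply: s1P; rewrite ?Ek.
have lt0 : gw bot s0 y0 < gw bot s1 y0 by rewrite E0 E1; lra.
have [M [c0 [c0' [c1 [c1' [[e0 e1] [wc0 wc0'] [wc1 wc1'] yM upP]]]]]] :=
  walks_meet_up D w0 w1 bot_le bot_le lt0.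
have cE0 y : y <= Y M -> gw bot c0 y = gw bot s0 y.
  by move=> h; rewrite e0 (gwalk_cat _ _ _ _ wc0) (gwalk_lo D wc0' h) addrK.
have cE1 y : y <= Y M -> gw bot c1 y = gw bot s1 y.
  by move=> h; rewrite e1 (gwalk_cat _ _ _ _ wc1) (gwalk_lo D wc1' h) addrK.
rewrite -cE0 ?(ltW yM)// -cE1 ?(ltW yM)// in lt0.
have [m [d0 [l [d1 [r [[f0 f1] [wd0 wl] [wd1 wr] ym dnP]]]]]] :=
  walks_meet_down wc0 wc1 (ltW yM) (ltW yM) lt0.
have lE y : Y m <= y -> gw bot c0 y = gw m l y.
  by move=> h; rewrite f0 (gwalk_cat _ _ _ _ wd0) (gwalk_hi D wd0 h); lra.
have rE y : Y m <= y -> gw bot c1 y = gw m r y.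
  by move=> h; rewrite f1 (gwalk_cat _ _ _ _ wd1) (gwalk_hi D wd1 h); lra.
exists m, M, l, r; split.
- split=> //; first by lra.
    move=> y my yM'; have [yy|yy] := leP y y0; first exact: dnP.
    by rewrite -lE ?(ltW my)// -rE ?(ltW my)//; apply: upP => //; apply: ltW.
  move=> k; have [s sw ks] := walk_through k.
  have [h|h] := side _ sw; [left|right] => y h1 h2 h3 h4.
    by rewrite -(gwalk_on D sw ks h3 h4) -lE// cE0.
  by rewrite -(gwalk_on D sw ks h3 h4) -rE// cE1.
(* The parts cut off at [m] and at [M] lie below and above [y0], whereas [k0] crosses [y0]; so [k0]
   stays in the middle part. *)
- move: k0s; rewrite e0 f0 !mem_cat => /orP[/orP[|//]|] h.
    by have [_ h'] := walk_mem_le D wd0 h; lra.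
  by have [h' _] := walk_mem_le D wc0' h; lra.
- move: k1s; rewrite e1 f1 !mem_cat => /orP[/orP[|//]|] h.
    by have [_ h'] := walk_mem_le D wd1 h; lra.
  by have [h' _] := walk_mem_le D wc1' h; lra.
- by split.
Qed.

End Cells.

(** * Topology of the plane *)

Lemma continuous_pair (R : realType) (f h : R -> R) :
  continuous f -> continuous h -> continuous (fun x => (f x, h x)).
Proof.
move=> cf ch x.
exact: (@cvg_pair _ _ _ _ (nbhs (f x)) (nbhs (h x)) _ _ _ f h (cf x) (ch x)).
Qed.

Lemma closed_le_continuous (R : realType) (T : topologicalType) (f h : T -> R) :
  continuous f -> continuous h -> closed [set z | f z <= h z].
Proof.
move=> cf ch; have -> : [set z | f z <= h z] = (fun z => h z - f z) @^-1` [set y | 0 <= y].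
  by apply/seteqP; split=> z /=; rewrite subr_ge0.
apply: closed_comp; last exact: closed_ge.
by move=> z _; apply: continuousB; [exact: ch|exact: cf].
Qed.

Lemma open_lt_continuous (R : realType) (T : topologicalType) (f h : T -> R) :
  continuous f -> continuous h -> open [set z | f z < h z].
Proof.
move=> cf ch; have -> : [set z | f z < h z] = ~` [set z | h z <= f z].
  by apply/seteqP; split=> z /=; [move=> h1; apply/negP; rewrite -ltNge|move/negP; rewrite -ltNge].
by apply: closed_openC; apply: closed_le_continuous.
Qed.

Lemma connected_row (R : realType) (I : set R) (y : R) :
  is_interval I -> connected [set z : R * R | I z.1 /\ z.2 = y].
Proof.
move=> iI; have -> : [set z : R * R | I z.1 /\ z.2 = y] = (fun x => (x, y)) @` I.
  apply/seteqP; split=> [[a b] /= [Ia ->]|_ [x Ix <-]//]; by exists a.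
apply: connected_continuous_connected; first exact/connected_intervalP.
by apply: continuous_subspaceT; apply: continuous_pair => x; [exact: cvg_id|exact: cvg_cst].
Qed.

Lemma connected_graph (R : realType) (I : set R) (f : R -> R) :
  is_interval I -> continuous f -> connected [set z : R * R | I z.2 /\ z.1 = f z.2].
Proof.
move=> iI cf; have -> : [set z : R * R | I z.2 /\ z.1 = f z.2] = (fun y => (f y, y)) @` I.
  apply/seteqP; split=> [[a b] /= [Ib ->]|_ [x Ix <-]//]; by exists b.
apply: connected_continuous_connected; first exact/connected_intervalP.
by apply: continuous_subspaceT; apply: continuous_pair => // x; exact: cvg_id.
Qed.

Lemma avoid_finite (R : realType) (s : seq R) (a b : R) : a < b ->
  exists y, [/\ a < y, y < b & y \notin s].
Proof.
elim: s b => [|x s IH] b ab; first by exists ((a + b) / 2); split=> //; lra.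
have [y [ay yb ys]] := IH _ ab.
have [yx|yx] := eqVneq y x; last by exists y; rewrite inE negb_or yx.
have [y' [ay' yy' ys']] := IH _ ay.
by exists y'; rewrite inE negb_or ys' -yx (lt_eqF yy'); split=> //; lra.
Qed.

(** * The region of a cell is a component of the complement *)

Section Region.
Variables (R : realType) (V K : finType).
Variables (X Y : V -> R) (src dst : K -> V) (g : K -> R -> R) (bot top : V).
Hypothesis D : drawing X Y src dst g bot top.
Local Notation walk := (walk src dst).
Local Notation gw := (gwalk X src g).

Definition skeleton : set (R * R) :=
  [set z | exists k, [/\ Y (src k) <= z.2, z.2 <= Y (dst k) & z.1 = g k z.2]].

Definition region m M l r : set (R * R) :=
  [set z | [/\ Y m < z.2, z.2 < Y M, gw m l z.2 < z.1 & z.1 < gw m r z.2]].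

Definition right_side k (F : set (R * R)) : Prop :=
  exists y, [/\ Y (src k) < y, y < Y (dst k) & exists2 e, 0 < e &
    forall s, 0 < s -> s < e -> F (g k y + s, y)].

Definition left_side k (F : set (R * R)) : Prop :=
  exists y, [/\ Y (src k) < y, y < Y (dst k) & exists2 e, 0 < e &
    forall s, 0 < s -> s < e -> F (g k y - s, y)].

Let fst_cont : continuous (fst : R * R -> R). Proof. by move=> z; exact: cvg_fst. Qed.
Let snd_cont : continuous (snd : R * R -> R). Proof. by move=> z; exact: cvg_snd. Qed.
Let comp_snd (f : R -> R) : continuous f -> continuous (fun z : R * R => f z.2).
Proof. by move=> cf z; apply: (@continuous_comp _ _ _ snd f); [exact: cvg_snd|exact: cf]. Qed.
Let cst_cont (c : R) : continuous (fun _ : R * R => c).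
Proof. by move=> z; exact: cvg_cst. Qed.

Lemma closed_skeleton : closed skeleton.
Proof.
have -> : skeleton = \bigcup_(k in [set: K]) ([set z | Y (src k) <= z.2] `&`
    [set z | z.2 <= Y (dst k)] `&` [set z | z.1 <= g k z.2] `&` [set z | g k z.2 <= z.1]).
  apply/seteqP; split=> [z [k [a b c]]|z [k _ [[[a b] c] d]]].
    by exists k => //; split; [split; [split|]|]; rewrite //= c lexx.
  by exists k; split=> //; apply/eqP; rewrite eq_le; apply/andP.
apply: closed_bigcup => [|k _]; first exact: finite_finset.
have cg := comp_snd (d_cont D (k := k)).
by apply: closedI; [apply: closedI; [apply: closedI|]|]; apply: closed_le_continuous.
Qed.

Lemma open_region m M l r : open (region m M l r).
Proof.
have -> : region m M l r = [set z | Y m < z.2] `&` [set z | z.2 < Y M] `&`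
    [set z | gw m l z.2 < z.1] `&` [set z | z.1 < gw m r z.2].
  by apply/seteqP; split=> [z []|z [[[]]]].
have cl := comp_snd (gwalk_continuous D (u := m) (s := l)).
have cr := comp_snd (gwalk_continuous D (u := m) (s := r)).
by apply: openI; [apply: openI; [apply: openI|]|]; apply: open_lt_continuous.
Qed.

Definition closed_region m M l r : set (R * R) :=
  [set z | [/\ Y m <= z.2, z.2 <= Y M, gw m l z.2 <= z.1 & z.1 <= gw m r z.2]].

Lemma closed_closed_region m M l r : closed (closed_region m M l r).
Proof.
have -> : closed_region m M l r = [set z | Y m <= z.2] `&` [set z | z.2 <= Y M] `&`
    [set z | gw m l z.2 <= z.1] `&` [set z | z.1 <= gw m r z.2].
  by apply/seteqP; split=> [z []|z [[[]]]].
have cl := comp_snd (gwalk_continuous D (u := m) (s := l)).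
have cr := comp_snd (gwalk_continuous D (u := m) (s := r)).
by apply: closedI; [apply: closedI; [apply: closedI|]|]; apply: closed_le_continuous.
Qed.

Lemma region_sub_closed m M l r : region m M l r `<=` closed_region m M l r.
Proof. by move=> z [/ltW ? /ltW ? /ltW ? /ltW ?]. Qed.

Section OneCell.
Variables (m M : V) (l r : seq K).
Hypothesis C : cell X Y src dst g m M l r.
Let wl := cell_l C.
Let wr := cell_r C.

Lemma region_compl : region m M l r `<=` ~` skeleton.
Proof.
move=> z [a b c d] [k [e f h]].
by have [/(_ z.2 (ltW a) (ltW b) e f)|/(_ z.2 (ltW a) (ltW b) e f)] := cell_out C k;
  rewrite -h; lra.
Qed.

Lemma walk_skeleton u s w y : walk u s w -> Y u <= y -> y <= Y w -> s != [::] ->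
  skeleton (gw u s y, y).
Proof.
move=> sw uy yw s0; have [yw'|wy] := ltP y (Y w).
  have [k [ks a b]] := gwalk_at sw uy yw'.
  by exists k; split=> //=; [exact: ltW|exact: (gwalk_on D sw ks a (ltW b))].
have lt : Y u < Y w by case: s s0 sw => // k s _ sw; apply: (walk_lt D sw (mem_head _ _)).
have [|k [ks a b]] := gwalk_at' sw _ yw; first by lra.
by exists k; split=> //=; [exact: ltW|exact: (gwalk_on D sw ks (ltW a) b)].
Qed.

Let l_nil : l != [::].
Proof. by apply/eqP => E; have := cell_lt C; move: wl; rewrite E => /eqP->; rewrite ltxx. Qed.
Let r_nil : r != [::].
Proof. by apply/eqP => E; have := cell_lt C; move: wr; rewrite E => /eqP->; rewrite ltxx. Qed.

(** The sides of the closed region belong to the skeleton. At the heights of [m] and [M] both walks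
    pass through the same vertex, so nothing lies strictly between them there. *)
Lemma closed_region_compl z : closed_region m M l r z -> ~ skeleton z -> region m M l r z.
Proof.
case: z => x y [/= a b c d] nz.
have lx : gw m l y != x.
  by apply/eqP => E; apply: nz; rewrite -E; apply: walk_skeleton wl _ _ l_nil.
have rx : gw m r y != x.
  by apply/eqP => E; apply: nz; rewrite -E; apply: walk_skeleton wr _ _ r_nil.
have {}c : gw m l y < x by rewrite lt_neqAle lx.
have {}d : x < gw m r y by rewrite lt_neqAle eq_sym rx.
split=> //=; rewrite lt_neqAle ?a ?b andbT; apply/eqP => E; move: c d.
  by rewrite (gwalk_lo D wl) -?E// (gwalk_lo D wr) -?E//; lra.
by rewrite (gwalk_hi D wl) -?E// (gwalk_hi D wr) -?E//; lra.
Qed.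

Let mid y := (gw m l y + gw m r y) / 2.
Let mid_cont : continuous mid.
Proof.
move=> y.
apply: (@continuousM _ _ (fun y => gw m l y + gw m r y) (fun=> 2^-1)); last exact: cvg_cst.
by apply: (@continuousD _ _ _ (gw m l) (gw m r)); apply: (gwalk_continuous D).
Qed.

Let spine := [set z : R * R | (Y m < z.2 /\ z.2 < Y M) /\ z.1 = mid z.2].

Let spine_sub : spine `<=` region m M l r.
Proof.
move=> [x y] [/= [a b] ->]; have := cell_in C a b; rewrite /mid.
by split=> //=; lra.
Qed.

(** Each point is joined by a horizontal row to the [spine], the curve halfway between the two
    walks, which is itself connected as a graph over an interval. *)
Lemma connected_region : connected (region m M l r).
Proof.
pose row (z : R * R) := [set w : R * R | (gw m l z.2 < w.1 /\ w.1 < gw m r z.2) /\ w.2 = z.2].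
have ii (a b : R) : is_interval [set y | a < y /\ y < b].
  by move=> x y /= [h1 h2] [h3 h4] t /andP[h5 h6]; split; lra.
have -> : region m M l r = \bigcup_(z in region m M l r) (spine `|` row z).
  apply/seteqP; split=> [z rz|z [w [a b c d] [/spine_sub//|[[e f] h]]]].
    by exists z => //; right; case: rz.
  by split; rewrite h.
have [e1 e2] : Y m < (Y m + Y M) / 2 /\ (Y m + Y M) / 2 < Y M by have := cell_lt C; split; lra.
apply: bigcup_connected.
  by exists (mid ((Y m + Y M) / 2), (Y m + Y M) / 2) => z rz; left.
move=> z [a b c d]; apply: connectedU.
- exists (mid z.2, z.2); split=> //; split=> //=; have := cell_in C a b; rewrite /mid; lra.
- exact: connected_graph (ii _ _) mid_cont.
- exact: connected_row (ii _ _).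
Qed.

(** The trace of the region on the component of [z] is nonempty and open, and it is closed because
    it is also the trace of the closed region. Connectedness makes it everything. *)
Lemma component_region z : region m M l r z ->
  connected_component (~` skeleton) z = region m M l r.
Proof.
move=> rz; apply/seteqP; split; last first.
  exact: connected_component_max rz region_compl connected_region.
set A := connected_component _ _.
have AC : A `<=` ~` skeleton by exact: connected_component_sub.
have cA : connected A by exact: component_connected.
rewrite -(cA (A `&` region m M l r)) => [w []//|||].
- by exists z; split=> //; apply: connected_component_refl; exact: region_compl.
- by exists (region m M l r) => //; exact: open_region.
- exists (closed_region m M l r); first exact: closed_closed_region.
  apply/seteqP; split=> w [Aw wr']; split=> //; first exact: region_sub_closed.
  exact: closed_region_compl (AC _ Aw).
Qed.

Lemma region_bounded : exists B : R, forall z, region m M l r z -> `|z.1| <= B /\ `|z.2| <= B.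
Proof.
have mM := ltW (cell_lt C).
have [a _ aP] := EVT_min mM (continuous_subspaceT (gwalk_continuous D (u := m) (s := l))).
have [b _ bP] := EVT_max mM (continuous_subspaceT (gwalk_continuous D (u := m) (s := r))).
exists (`|Y m| + `|Y M| + `|gw m l a| + `|gw m r b|) => z [h1 h2 h3 h4].
have zi : z.2 \in `[Y m, Y M] by rewrite in_itv /= !ltW.
have := aP _ zi; have := bP _ zi; rewrite !ler_norml.
have n1 := ler_norm (Y m); have n2 := ler_norm (Y M).
have n3 := ler_norm (gw m l a); have n4 := ler_norm (gw m r b).
have m1 := ler_norm (- Y m); have m2 := ler_norm (- Y M).
have m3 := ler_norm (- gw m l a); have m4 := ler_norm (- gw m r b).
rewrite !normrN in m1 m2 m3 m4.
have p1 := normr_ge0 (Y m); have p2 := normr_ge0 (Y M).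
have p3 := normr_ge0 (gw m l a); have p4 := normr_ge0 (gw m r b).
by move=> q1 q2; split; apply/andP; split; lra.
Qed.

(** Having the region on its right at a single height puts [k] at or to the right of the left walk
    there; [cell_out] then forces equality, and distinct edges share no interior point. In the other
    direction the width of the cell at mid-height of [k] is the admissible shift. *)
Lemma right_sideP k : right_side k (region m M l r) <-> k \in l.
Proof.
split=> [[y [a b [e e0 eP]]]|kl].
  have [h1 h2 _ h3] : region m M l r (g k y + e / 2, y) by apply: eP; lra.
  move: h1 h2 h3 => /= h1 h2 h3.
  have le : gw m l y <= g k y.
    rewrite leNgt; apply/negP => lt.
    pose s := Num.min (e / 2) (gw m l y - g k y).
    have s0 : 0 < s by rewrite lt_min; apply/andP; split; lra.
    have [s1 s2] : s <= e / 2 /\ s <= gw m l y - g k y by rewrite /s !ge_min !lexx orbT.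
    by have [|_ _ /= + _] := eP s s0; lra.
  have E : g k y = gw m l y.
    have [/(_ y (ltW h1) (ltW h2) (ltW a) (ltW b))|/(_ y (ltW h1) (ltW h2) (ltW a) (ltW b))] :=
      cell_out C k; lra.
  have [j [jl j1 j2]] := gwalk_at wl (ltW h1) h2.
  rewrite (gwalk_on D wl jl j1 (ltW j2)) in E.
  have [->//|kj] := eqVneq k j.
  by have [|] := d_nc D kj (ltW a) (ltW b) j1 (ltW j2) E; lra.
have kd := d_up D k; pose y := (Y (src k) + Y (dst k)) / 2.
have [a b] : Y (src k) < y /\ y < Y (dst k) by rewrite /y; split; lra.
have [h1 h2] := walk_mem_le D wl kl.
have [my yM] : Y m < y /\ y < Y M by split; lra.
exists y; split=> //; exists (gw m r y - gw m l y); first by have := cell_in C my yM; lra.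
move=> s s0 s1; rewrite -(gwalk_on D wl kl (ltW a) (ltW b)).
by split=> //=; lra.
Qed.

Lemma vertex_skeleton v : bot != top -> skeleton (X v, Y v).
Proof.
move=> bt; have [vt|/(d_out D)[k kv]] := eqVneq v top.
  have [|k kv] := d_in D (v := v); first by rewrite vt eq_sym.
  by exists k; rewrite /= -kv (d_hi D)// lexx ltW ?(d_up D).
by exists k; rewrite /= -kv (d_lo D)// lexx ltW ?(d_up D).
Qed.

(** A vertex of the closure lies in the closed region but, belonging to the skeleton, not in the
    open one. So it is on one of the two walks, and vertices are never interior to an edge. *)
Lemma closure_region_vertex v : bot != top -> closure (region m M l r) (X v, Y v) ->
  exists k, (k \in l) || (k \in r) /\ (v = src k \/ v = dst k).
Proof.
move=> bt cv.
have : closed_region m M l r (X v, Y v).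
  rewrite [X in X _](closure_id (closed_region m M l r)).1; last exact: closed_closed_region.
  exact: closure_subset (@region_sub_closed _ _ _ _) _ cv.
move=> cr; have : ~ region m M l r (X v, Y v).
  by move=> /region_compl; apply; apply: vertex_skeleton.
have on u s w : walk u s w -> Y u <= Y v -> Y v <= Y w -> Y u < Y w ->
    X v = gw u s (Y v) -> exists2 k, k \in s & v = src k \/ v = dst k.
  move=> sw uv vw uw E.
  have [k [ks a b]] : exists k, [/\ k \in s, Y (src k) <= Y v & Y v <= Y (dst k)].
    have [vw'|wv] := ltP (Y v) (Y w).
      by have [k [ks a b]] := gwalk_at sw uv vw'; exists k; split=> //; apply: ltW.
    by have [|k [ks a b]] := gwalk_at' (y := Y v) sw _ vw; [lra|exists k; split=> //; apply: ltW].
  exists k => //; rewrite (gwalk_on D sw ks a b) in E.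
  move: a b; rewrite !le_eqVlt => /orP[/eqP a _|a /orP[/eqP b|b]].
  - by left; apply: (d_inj D) => //; rewrite E (d_lo D)// a.
  - by right; apply: (d_inj D) => //; rewrite E (d_hi D)// b.
  - by case: (d_nv D a b).
move=> nr; case: (cr) => /= a b c d; have lt := cell_lt C.
have [E|lx] := eqVneq (X v) (gw m l (Y v)).
  by have [k kl kv] := on _ _ _ wl a b lt E; exists k; rewrite kl.
have [E|rx] := eqVneq (X v) (gw m r (Y v)).
  by have [k kl kv] := on _ _ _ wr a b lt E; exists k; rewrite kl orbT.
have {}c : gw m l (Y v) < X v by rewrite lt_neqAle eq_sym lx.
have {}d : X v < gw m r (Y v) by rewrite lt_neqAle rx.
case: nr; split=> //=; rewrite lt_neqAle ?a ?b andbT; apply/eqP => E; move: c d.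
  by rewrite (gwalk_lo D wl) -?E// (gwalk_lo D wr) -?E//; lra.
by rewrite (gwalk_hi D wl) -?E// (gwalk_hi D wr) -?E//; lra.
Qed.

(** The point is approached along the [spine]: shifting the height by [q / 2] towards the middle
    height [c] stays within the given ball and strictly between [m] and [M]. *)
Let closure_mid (t : R) : Y m <= t -> t <= Y M -> closure (region m M l r) (mid t, t).
Proof.
move=> mt tM B nB; have lt := cell_lt C.
have pc : {for t, continuous (fun y => (mid y, y))}.
  by apply: continuous_pair => // y; exact: cvg_id.
have /nbhs_ballP[e /= e0 eB] := pc _ nB.
pose c := (Y m + Y M) / 2; pose q := Num.min (e / 2) (c - Y m).
have q0 : 0 < q by rewrite lt_min; apply/andP; split; rewrite /c; lra.
have [q1 q2] : q <= e / 2 /\ q <= c - Y m by rewrite /q !ge_min !lexx orbT.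
have inB y : `|t - y| < e -> Y m < y -> y < Y M -> region m M l r `&` B !=set0.
  move=> ty my yM; exists (mid y, y); split; first exact: spine_sub.
  exact: eB.
have [tc|ct] := leP t c.
  apply: (inB (t + q / 2)); rewrite ?ltr_norml; try (apply/andP; split); move: q2; rewrite /c in tc *; lra.
apply: (inB (t - q / 2)); rewrite ?ltr_norml; try (apply/andP; split); move: q2; rewrite /c in ct *; lra.
Qed.

Lemma closure_region_m : closure (region m M l r) (X m, Y m).
Proof.
have mM := ltW (cell_lt C); have := closure_mid (lexx _) mM.
rewrite /mid (gwalk_lo D wl)// (gwalk_lo D wr)// (_ : (X m + X m) / 2 = X m)//; lra.
Qed.

Lemma closure_region_M : closure (region m M l r) (X M, Y M).
Proof.
have mM := ltW (cell_lt C); have := closure_mid mM (lexx _).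
rewrite /mid (gwalk_hi D wl)// (gwalk_hi D wr)// (_ : (X M + X M) / 2 = X M)//; lra.
Qed.

End OneCell.
End Region.

(** * Bounded components of the complement are cells *)

Section Faces.
Variables (R : realType) (V K : finType).
Variables (X Y : V -> R) (src dst : K -> V) (g : K -> R -> R) (bot top : V).
Hypothesis D : drawing X Y src dst g bot top.
Local Notation walk := (walk src dst).
Local Notation gw := (gwalk X src g).
Local Notation skeleton := (skeleton Y src dst g).
Local Notation region := (region X Y src g).

Lemma cell_flipX m M l r : cell X Y src dst g m M l r ->
  cell (fun v => - X v) Y src dst (fun k y => - g k y) m M r l.
Proof.
case=> wl wr lt inn out; split=> //.
  by move=> y a b; rewrite !gwalk_flipX ltrN2; apply: inn.
move=> k; have [h|h] := out k; [right|left] => y *; rewrite !gwalk_flipX lerN2; exact: h.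
Qed.

Lemma left_sideP m M l r k : cell X Y src dst g m M l r ->
  left_side Y src dst g k (region m M l r) <-> k \in r.
Proof.
move=> C; rewrite -(right_sideP (drawing_flipX D) (cell_flipX C)).
split=> -[y [a b [e e0 eP]]]; exists y; split=> //; exists e => // s s0 se.
  have [h1 h2 h3 h4] := eP s s0 se; split=> //=; rewrite gwalk_flipX; move: h3 h4 => /=; lra.
have [h1 h2] := eP s s0 se; rewrite !gwalk_flipX /= => h3 h4; split=> //=; lra.
Qed.

Variables (kL kR : K).
Hypotheses (sL : src kL = bot) (dL : dst kL = top) (sR : src kR = bot) (dR : dst kR = top).
Hypothesis stripL : forall k y, Y (src k) <= y -> y <= Y (dst k) -> g kL y <= g k y.
Hypothesis stripR : forall k y, Y (src k) <= y -> y <= Y (dst k) -> g k y <= g kR y.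

Lemma height_bounds v : Y bot <= Y v /\ Y v <= Y top.
Proof.
have [k vk] : exists k, v = src k \/ v = dst k.
  have [->|/(d_out D)[k <-]] := eqVneq v top; last by exists k; left.
  by exists kL; right.
have [s sw ks] := walk_through D k; have [h1 h2] := walk_mem_le D sw ks.
have := d_up D k; case: vk => ->; split; lra.
Qed.

Lemma generic_cell z : ~ skeleton z -> (forall v, Y v != z.2) ->
  [/\ Y bot < z.2, z.2 < Y top, g kL z.2 < z.1 & z.1 < g kR z.2] ->
  exists m M l r, cell X Y src dst g m M l r /\ region m M l r z.
Proof.
case: z => x y /= nz gen [h1 h2 h3 h4].
pose P0 k := [&& Y (src k) < y, y < Y (dst k) & g k y < x].
pose P1 k := [&& Y (src k) < y, y < Y (dst k) & x < g k y].
have P0L : P0 kL by rewrite /P0 sL dL h1 h2.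
have P1R : P1 kR by rewrite /P1 sR dR h1 h2.
case: (@arg_maxP _ _ _ kL P0 (fun k => g k y) P0L) => k0 /and3P[a0 b0 c0] max0.
case: (@arg_minP _ _ _ kR P1 (fun k => g k y) P1R) => k1 /and3P[a1 b1 c1] min1.
have [|m [M [l [r [C k0l k1r [my yM]]]]]] := cell_exists D gen a0 b0 a1 b1 c0 c1.
  move=> k a b; have [lt|gt|E] := ltgtP (g k y) x.
  - by left; apply: max0; rewrite /P0 a b.
  - by right; apply: min1; rewrite /P1 a b.
  - by case: nz; exists k; rewrite /= E !ltW.
exists m, M, l, r; split=> //; split=> //=.
  by rewrite (gwalk_on D (cell_l C) k0l (ltW a0) (ltW b0)).
by rewrite (gwalk_on D (cell_r C) k1r (ltW a1) (ltW b1)).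
Qed.

(** The cell is spanned by [k] and the nearest edge to its right at a height without vertices; [kR]
    is a candidate, so a nearest one exists. *)
Lemma cell_right_of_edge k : k != kR ->
  exists m M l r, cell X Y src dst g m M l r /\ k \in l.
Proof.
move=> kkR.
have [y [a b gen]] := avoid_finite (map Y (enum V)) (d_up D k).
have {}gen v : Y v != y.
  by apply: contraNneq gen => <-; apply: map_f; rewrite mem_enum.
have [[h1 _] [_ h2]] := (height_bounds (src k), height_bounds (dst k)).
pose P1 j := [&& Y (src j) < y, y < Y (dst j) & g k y < g j y].
have P1R : P1 kR.
  rewrite /P1 sR dR (le_lt_trans h1 a) (lt_le_trans b h2) lt_neqAle stripR ?ltW// andbT /=.
  apply/eqP => E; have [|||] := d_nc D kkR (ltW a) (ltW b) _ _ E; rewrite ?sR ?dR; lra.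
case: (@arg_minP _ _ _ kR P1 (fun k => g k y) P1R) => k1 /and3P[a1 b1 c1] min1.
have [|||m [M [l [r [C kl _ _]]]]] :=
  @cell_exists _ _ _ _ _ _ _ _ _ _ D k k1 ((g k y + g k1 y) / 2) y gen a b a1 b1; try lra.
  move=> j aj bj; have [le|lt] := leP (g j y) (g k y); first by left.
  by right; apply: min1; rewrite /P1 aj bj.
by exists m, M, l, r.
Qed.

(** Outside the strip one of the two horizontal rays from [z] avoids the skeleton. It is connected,
    hence contained in the component, and it leaves every bounded set. *)
Lemma bounded_component_strip z : ~ skeleton z ->
  (exists B : R, forall w, connected_component (~` skeleton) z w -> `|w.1| <= B /\ `|w.2| <= B) ->
  [/\ Y bot < z.2, z.2 < Y top, g kL z.2 < z.1 & z.1 < g kR z.2].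
Proof.
case: z => x y nz [B BP].
have ray (I : set R) : is_interval I -> I x -> (forall t, I t -> ~ skeleton (t, y)) ->
    forall t, I t -> `|t| <= B.
  move=> iI Ix Isk t It; apply: (BP (t, y) _).1.
  apply: (@connected_component_max _ _ [set w : R * R | I w.1 /\ w.2 = y]) => //.
    by move=> [a b] [/= Ia ->]; apply: Isk.
  exact: connected_row.
have Bge : B < Num.max 0 B + 1 by rewrite (le_lt_trans (y := Num.max 0 B)) ?ltrDl// le_max lexx orbT.
set N := Num.max 0 B + 1 in Bge.
have Npos : 0 < N by rewrite /N ltr_pwDr// le_max lexx.
have left_ray : (forall t, t <= x -> ~ skeleton (t, y)) -> False.
  move=> h; have := ray [set t | t <= x] _ (lexx _) h (Num.min x (- N)).
  have [q1 q2] : Num.min x (- N) <= x /\ Num.min x (- N) <= - N by rewrite !ge_min !lexx orbT.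
  rewrite ler_norml => /(_ _ q1) => /(_ _)/andP[|n1 n2].
    by move=> a b /= _ bx c /andP[_ cb]; apply: le_trans bx.
  lra.
have right_ray : (forall t, x <= t -> ~ skeleton (t, y)) -> False.
  move=> h; have := ray [set t | x <= t] _ (lexx _) h (Num.max x N).
  have [q1 q2] : x <= Num.max x N /\ N <= Num.max x N by rewrite !le_max !lexx orbT.
  rewrite ler_norml => /(_ _ q1) => /(_ _)/andP[|n1 n2].
    by move=> a b /= xa _ c /andP[ac _]; apply: le_trans ac.
  lra.
have skL : Y bot <= y -> y <= Y top -> skeleton (g kL y, y) by exists kL; rewrite /= sL dL.
have skR : Y bot <= y -> y <= Y top -> skeleton (g kR y, y) by exists kR; rewrite /= sR dR.
have [by_ yt] : Y bot <= y /\ y <= Y top.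
  suff /andP[] : (Y bot <= y) && (y <= Y top) by [].
  apply/negPn/negP => out; apply: left_ray => t _ [k [/= a b _]].
  have [h1 h2] := height_bounds (src k); have [h3 h4] := height_bounds (dst k).
  by move/negP: out; apply; apply/andP; split; lra.
have lx : g kL y <= x.
  rewrite leNgt; apply/negP => lt; apply: left_ray => t tx [k [/= a b E]].
  by have := stripL a b; lra.
have xr : x <= g kR y.
  rewrite leNgt; apply/negP => lt; apply: right_ray => t tx [k [/= a b E]].
  by have := stripR a b; lra.
have {}lx : g kL y < x.
  by rewrite lt_neqAle lx andbT; apply/eqP => E; apply: nz; rewrite -E; apply: skL.
have {}xr : x < g kR y.
  by rewrite lt_neqAle xr andbT; apply/eqP => E; apply: nz; rewrite E; apply: skR.
split=> //=; rewrite lt_neqAle ?by_ ?yt andbT; apply/eqP => E; move: lx xr.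
  by rewrite (d_lo D (k := kL)) ?sL -?E// (d_lo D (k := kR)) ?sR -?E//; lra.
by rewrite (d_hi D (k := kL)) ?dL -?E// (d_hi D (k := kR)) ?dR -?E//; lra.
Qed.

(** The complement is open, so it contains a short vertical segment above [z], and only finitely
    many heights carry a vertex. *)
Lemma generic_point z : ~ skeleton z -> exists z',
  connected_component (~` skeleton) z z' /\ forall v, Y v != z'.2.
Proof.
case: z => x y nz.
have /nbhs_ballP[e /= e0 eP] : nbhs (x, y) (~` skeleton).
  by apply: open_nbhs_nbhs; split=> //; apply: closed_openC; exact: closed_skeleton D.
have [y' [a b gen]] := @avoid_finite _ (map Y (enum V)) y (y + e) ltac:(lra).
exists (x, y'); split; last first.
  by move=> v /=; apply: contraNneq gen => <-; apply: map_f; rewrite mem_enum.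
apply: (@connected_component_max _ _ [set w : R * R | (y <= w.2 /\ w.2 < y + e) /\ w.1 = x]) => /=.
- by split=> //; split=> //; lra.
- move=> [u v] [/= [h1 h2] ->]; apply: eP; split; first exact: ballxx.
  by rewrite /ball /= ltr_norml; apply/andP; split; lra.
- apply: (@connected_graph _ [set v | y <= v /\ v < y + e] (fun=> x)); last by move=> ?; exact: cvg_cst.
  by move=> u v /= [h1 h2] [h3 h4] t /andP[h5 h6]; split; lra.
- by split=> //; split=> //; lra.
Qed.

Lemma bounded_component_cell z : ~ skeleton z ->
  (exists B : R, forall w, connected_component (~` skeleton) z w -> `|w.1| <= B /\ `|w.2| <= B) ->
  exists m M l r, cell X Y src dst g m M l r /\
    connected_component (~` skeleton) z = region m M l r.
Proof.
move=> nz; have [z' [zz gen]] := generic_point nz.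
rewrite (same_connected_component zz) => bd.
have nz' := connected_component_sub zz.
have [m [M [l [r [C rz]]]]] := generic_cell nz' gen (bounded_component_strip nz' bd).
by exists m, M, l, r; split=> //; exact: component_region D _ _ _ _ C _ rz.
Qed.

Lemma cell_component m M l r : cell X Y src dst g m M l r ->
  exists z, ~ skeleton z /\ region m M l r = connected_component (~` skeleton) z.
Proof.
move=> C; have lt := cell_lt C; pose y := (Y m + Y M) / 2.
have [a b] : Y m < y /\ y < Y M by rewrite /y; split; lra.
have h := cell_in C a b.
have rz : region m M l r ((gw m l y + gw m r y) / 2, y) by split=> //=; lra.
exists ((gw m l y + gw m r y) / 2, y); split; first exact: (region_compl C rz).
by rewrite (component_region D C rz).
Qed.

End Faces.

(** * Cells to the right of an incoming edge *)

Section Incoming.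
Variables (R : realType) (V K : finType).
Variables (X Y : V -> R) (src dst : K -> V) (g : K -> R -> R) (bot top : V).
Hypothesis D : drawing X Y src dst g bot top.
Local Notation walk := (walk src dst).
Local Notation gw := (gwalk X src g).

Lemma walk_range_disjoint u s w j k y : walk u s w -> j \in s -> k \in s ->
  Y (src j) < y -> y < Y (dst j) -> Y (src k) <= y -> y <= Y (dst k) -> j = k.
Proof.
move=> sw js ks a b c d; have [//|jk] := eqVneq j k.
have E : g j y = g k y.
  by rewrite -(gwalk_on D sw js (ltW a) (ltW b)) (gwalk_on D sw ks c d).
by have [h|h] := d_nc D jk (ltW a) (ltW b) c d E; move: a b; rewrite h ltxx.
Qed.

(** Since [e'] is to the right of [e] and cannot enter the cell, the right walk is squeezed between
    them. As [e] and [e'] end at the same vertex, the cell closes there, and its last right edge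
    [e2] lies between [e] and [e']. *)
Lemma cell_max_incoming m M l r e e' y : cell X Y src dst g m M l r -> e \in l ->
  dst e' = dst e -> Y (src e) < y -> y < Y (dst e) -> Y (src e') < y ->
  g e y < g e' y -> exists l1 r1 e2,
    [/\ M = dst e, l = rcons l1 e, r = rcons r1 e2 &
        forall z, Y (src e) < z -> Y (src e2) < z -> z < Y (dst e) ->
          g e z < g e2 z /\ (Y (src e') < z -> g e2 z <= g e' z)].
Proof.
move=> C el dd a b a' lt; have wl := cell_l C; have wr := cell_r C.
have [me eM] := walk_mem_le D wl el.
have b' : y < Y (dst e') by rewrite dd.
have ub : forall z, Y m <= z -> z <= Y M -> Y (src e') <= z -> z <= Y (dst e') ->
    gw m r z <= g e' z.
  have [h|//] := cell_out C e'; have {}h : g e' y <= gw m l y by apply: h; lra.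
  by move: h; rewrite (gwalk_on D wl el (ltW a) (ltW b)); lra.
have top_l : gw m l (Y (dst e)) = X (dst e).
  by rewrite (gwalk_on D wl el) ?lexx ?(d_hi D)//; lra.
have eqM : Y (dst e) = Y M.
  apply/eqP; rewrite eq_le eM leNgt; apply/negP => h.
  have h' : Y m < Y (dst e) by have := d_up D e; lra.
  have := cell_in C h' h; rewrite top_l.
  have : gw m r (Y (dst e)) <= g e' (Y (dst e)) by apply: ub; rewrite ?dd; lra.
  by rewrite (d_hi D (k := e')) ?dd//; lra.
have ME : M = dst e.
  by apply: (d_inj D) => //; rewrite -top_l (gwalk_hi D wl)// eqM.
case/lastP: l C el wl {ub} top_l (ub) => [|l1 e0] C el wl top_l ub; first by [].
have [wl1 de0] := walk_rconsE wl.
have ee0 : e = e0.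
  move: el; rewrite mem_rcons inE => /predU1P[//|el1].
  by exfalso; have [_] := walk_mem_le D wl1 el1; have := d_up D e0; rewrite de0; lra.
case/lastP: r C wr ub => [|r1 e2] C wr ub.
  by have := cell_lt C; move: wr => /= /eqP->; rewrite ltxx.
have [wr1 de2] := walk_rconsE wr.
have e2r : e2 \in rcons r1 e2 by rewrite mem_rcons mem_head.
have me2 := (walk_mem_le D wr e2r).1.
exists l1, r1, e2; split=> //; first by rewrite ee0.
move=> z z1 z2 z3.
have in_z : g e z < g e2 z.
  rewrite -(gwalk_on D wl el); [|lra..].
  rewrite -(gwalk_on D wr e2r); [|lra|by rewrite de2; lra].
  by apply: (cell_in C); lra.
split=> // z4; rewrite -(gwalk_on D wr e2r); [|lra|by rewrite de2; lra].
by apply: ub; rewrite ?dd; lra.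
Qed.

End Incoming.

(** * From upward curves to graphs over heights *)

Lemma within_continuous_comp (S T U : topologicalType) (A : set S) (B : set T)
    (f : S -> T) (h : T -> U) : {within A, continuous f} ->
  (forall x, A x -> B (f x)) -> {within B, continuous h} ->
  {within A, continuous (fun x => h (f x))}.
Proof.
move=> /subspace_continuousP cf fAB /subspace_continuousP ch.
apply/subspace_continuousP => x Ax W /(ch _ (fAB _ Ax)) hW.
have cW : nbhs x (fun t => A t -> B (f t) -> W (h (f t))) := cf _ Ax _ hW.
suff : nbhs x (fun t => A t -> W (h (f t))) by [].
by move: cW; apply: filterS => t H At; apply: H => //; apply: fAB.
Qed.

(** Height is a continuous strictly increasing function of the parameter, so its inverse [hi] is
    continuous on the segment of heights. Clamping the height to that segment first makes [f] total
    and constant outside. *)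
Lemma upcurve_graph (R : realType) (g : R -> R * R) (a b : R * R) : upcurve g a b ->
  exists f : R -> R, [/\ continuous f,
    forall y, y <= a.2 -> f y = a.1, forall y, b.2 <= y -> f y = b.1,
    forall t, 0 <= t -> t <= 1 -> f (g t).2 = (g t).1 &
    forall y, a.2 <= y -> y <= b.2 -> exists t, [/\ 0 <= t, t <= 1 & (g t).2 = y]].
Proof.
case=> cg [ga [gb mono]].
pose h t := (g t).2.
have csnd : {within [set: R * R], continuous snd}.
  by apply: continuous_subspaceT => z; exact: cvg_snd.
have cfst : {within [set: R * R], continuous fst}.
  by apply: continuous_subspaceT => z; exact: cvg_fst.
have ch : {within `[0, 1], continuous h}.
  exact: (within_continuous_comp cg _ csnd).
have ab : a.2 < b.2 by rewrite -ga -gb; apply: mono.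
have inj s t : 0 <= s -> s <= 1 -> 0 <= t -> t <= 1 -> h s = h t -> s = t.
  move=> s0 s1 t0 t1 E; have [st|ts|//] := ltgtP s t.
    by have := mono _ _ s0 st t1; rewrite /h in E; rewrite E ltxx.
  by have := mono _ _ t0 ts s1; rewrite /h in E; rewrite E ltxx.
have surj y : a.2 <= y -> y <= b.2 -> exists t, [/\ 0 <= t, t <= 1 & h t = y].
  move=> ay yb; have [|c] := IVT (v := y) ler01 ch.
    by rewrite /h ga gb ge_min le_max ay yb orbT.
  by rewrite in_itv /= => /andP[c0 c1] E; exists c.
pose hi y := xget 0 [set t | [/\ 0 <= t, t <= 1 & h t = y]].
have hiP y : a.2 <= y -> y <= b.2 -> [/\ 0 <= hi y, hi y <= 1 & h (hi y) = y].
  move=> ay yb; have [t tP] := surj y ay yb.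
  exact: (@xgetPex _ 0 [set t | [/\ 0 <= t, t <= 1 & h t = y]] (ex_intro _ t tP)).
have bnd t : 0 <= t -> t <= 1 -> a.2 <= h t /\ h t <= b.2.
  move=> t0 t1; rewrite -ga -gb -/(h 0) -/(h 1); split.
    by move: t0; rewrite le_eqVlt => /orP[/eqP->//|t0]; apply: ltW; apply: mono.
  by move: t1; rewrite le_eqVlt => /orP[/eqP->//|t1]; apply: ltW; apply: mono.
have hiK t : 0 <= t -> t <= 1 -> hi (h t) = t.
  move=> t0 t1; have [h1 h2] := bnd t t0 t1; have [h3 h4 h5] := hiP _ h1 h2.
  exact: inj.
have chi : {within `[a.2, b.2], continuous hi}.
  have := @segment_can_le_continuous _ 0 1 h hi ler01 ch; rewrite /h ga gb; apply.
  by move=> t; rewrite in_itv /= => /andP[]; exact: hiK.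
pose clamp y := Num.max a.2 (Num.min y b.2).
have clP y : a.2 <= clamp y /\ clamp y <= b.2.
  by rewrite le_max lexx ge_max ge_min lexx orbT (ltW ab).
have ccl : continuous clamp.
  move=> y; apply: (@continuous_max _ _ (fun=> a.2) (fun y => Num.min y b.2)); first exact: cvg_cst.
  by apply: (@continuous_min _ _ id (fun=> b.2)); [exact: cvg_id|exact: cvg_cst].
exists (fun y => (g (hi (clamp y))).1); split.
- apply/continuous_subspace_setT.
  apply: (@within_continuous_comp _ _ _ setT `[a.2, b.2] clamp (fun y => (g (hi y)).1)).
  + exact: continuous_subspaceT.
  + by move=> y _ /=; rewrite in_itv /=; have [-> ->] := clP y.
  apply: (@within_continuous_comp _ _ _ _ setT (fun y => g (hi y)) fst) => //.
  apply: (within_continuous_comp chi _ cg) => y.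
  by rewrite /= !in_itv /= => /andP[h1 h2]; have [-> ->] := hiP _ h1 h2.
- move=> y ya; have -> : clamp y = h 0.
    rewrite /h ga /clamp; apply/eqP; rewrite eq_le le_max lexx ge_max lexx /= andbT.
    by rewrite ge_min ya.
  by rewrite hiK// ga.
- move=> y yb; have -> : clamp y = h 1.
    by rewrite /h gb /clamp min_r// max_r// ltW.
  by rewrite hiK// gb.
- move=> t t0 t1; have [h1 h2] := bnd t t0 t1.
  have -> : clamp (g t).2 = h t by rewrite /clamp -/(h t) min_l// max_r.
  by rewrite hiK.
- by move=> y ay yb; exact: surj.
Qed.

(** * The extended poset and its saturated chains *)

Section HatPoset.
Variables (d : Order.disp_t) (P : finPOrderType d).
Implicit Types u v w : hatP P.

Lemma hle_refl v : hle v v.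
Proof. by case: v => [[]|p] /=. Qed.

Lemma hle_trans v u w : hle u v -> hle v w -> hle u w.
Proof. by case: u v w => [[]|p] [[]|q] [[]|r] //=; apply: le_trans. Qed.

Lemma hle_anti u v : hle u v -> hle v u -> u = v.
Proof.
case: u v => [[]|p] [[]|q] //= pq qp; congr inr; apply/eqP.
by rewrite eq_le pq.
Qed.

Lemma hle_bot v : hle (hbot P) v. Proof. by []. Qed.
Lemma hle_top v : hle v (htop P). Proof. by case: v => [[]|]. Qed.

Lemma hlt_le u v : hlt u v -> hle u v. Proof. by case/andP. Qed.

Lemma hlt_nle u v : hlt u v -> ~~ hle v u.
Proof. by case/andP=> /eqP ne uv; apply/negP => /(hle_anti uv). Qed.

Lemma hlt_trans v u w : hlt u v -> hlt v w -> hlt u w.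
Proof.
move=> uv vw; rewrite /hlt (hle_trans (hlt_le uv) (hlt_le vw)) andbT.
apply/eqP => E; move: (hlt_nle vw); rewrite -E; apply/negP/negPn; exact: hlt_le.
Qed.

Lemma edge_lt (e : HEdge P) : hlt (etail e) (ehead e).
Proof. by case/andP: (valP e). Qed.

Lemma hle_walk u w : hle u w -> exists s, walk (@etail _ P) (@ehead _ P) u s w.
Proof.
have [n] := ubnP #|[pred z | hlt u z && hle z w]|; elim: n u => // n IH u cu uw.
have [->|ne] := eqVneq u w; first by exists [::] => /=.
pose Z z := hlt u z && hle z w.
have Zw : Z w by rewrite /Z /hlt ne uw hle_refl.
(* Among the elements above [u] and at most [w], one with the fewest elements between it and [u]
   covers [u]. *)
case: (@arg_minnP _ w Z (fun z => #|[pred x | hlt u x && hlt x z]|) Zw) => z /andP[uz zw] zmin.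
have cov : hcover u z.
  rewrite /hcover uz; apply/existsPn => x; apply/negP => /andP[ux xz].
  have := zmin x; rewrite /Z ux (hle_trans (hlt_le xz) zw) => /(_ isT).
  rewrite leqNgt => /negP; apply; apply: proper_card; apply/properP; split.
    by apply/fintype.subsetP => t; rewrite !inE => /andP[-> /hlt_trans]; apply.
  by exists x; rewrite !inE ?ux ?xz //= /hlt eqxx.
have [|s sw] := IH z _ zw.
  rewrite -ltnS; apply: leq_trans cu; rewrite ltnS; apply: proper_card; apply/properP; split.
    by apply/fintype.subsetP => t; rewrite !inE => /andP[/(hlt_trans uz) -> ->].
  by exists z; rewrite !inE ?uz ?zw //= /hlt eqxx.
by exists (exist _ (u, z) cov :: s); rewrite /= /etail /ehead /= eqxx.
Qed.

Lemma edge_out v : v != htop P -> exists e : HEdge P, etail e = v.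
Proof.
move=> vt; have [[|e s]] := hle_walk (hle_top v); first by move/eqP => E; rewrite E eqxx in vt.
by move=> /walk_consE[->]; exists e.
Qed.

Lemma edge_in v : v != hbot P -> exists e : HEdge P, ehead e = v.
Proof.
move=> vb; have [s] := hle_walk (hle_bot v); case/lastP: s => [/eqP E|s e].
  by rewrite -E eqxx in vb.
by move=> /walk_rconsE[_ <-]; exists e.
Qed.

End HatPoset.

(** * The bounded embedding as a drawing *)

Section Curves.
Variables (R : realType) (d : Order.disp_t) (P : finPOrderType d).

(* The edges of the bounded embedding: the Hasse edges, [inr false] for the
   additional left edge and [inr true] for the additional right edge. *)
Definition bedge := (HEdge P + bool)%type.
Definition bsrc (k : bedge) : hatP P := if k is inl e then etail e else hbot P.
Definition bdst (k : bedge) : hatP P := if k is inl e then ehead e else htop P.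

Variables (pos : hatP P -> R * R) (c : HEdge P -> R -> R * R) (cL cR : R -> R * R).
Definition bcurve (k : bedge) : R -> R * R :=
  match k with inl e => c e | inr false => cL | inr true => cR end.

Lemma bedge_lt k : hlt (bsrc k) (bdst k).
Proof. by case: k => [e|[]] //=; exact: edge_lt. Qed.

Lemma bwalk_le u s w : walk bsrc bdst u s w -> hle u w.
Proof.
elim: s u => [|k s IH] u /=; first by move/eqP->; exact: hle_refl.
by case/andP=> /eqP<- /IH; apply: hle_trans (hlt_le (bedge_lt k)).
Qed.

Hypothesis BD : bounded_drawing pos c cL cR.

Let X v := (pos v).1.
Let Y v := (pos v).2.

Lemma bcurve_up k : upcurve (bcurve k) (pos (bsrc k)) (pos (bdst k)).
Proof. by case: BD => -[_ [+ _]] [+ [+ _]]; case: k => [e|[]] /=. Qed.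

Lemma bcurve_mono k s t : 0 <= s -> s < t -> t <= 1 -> (bcurve k s).2 < (bcurve k t).2.
Proof. by case: (bcurve_up k) => _ [_ [_]]; apply. Qed.

Lemma bcurve_lt k : Y (bsrc k) < Y (bdst k).
Proof.
by case: (bcurve_up k) => _ [E0 [E1 _]]; rewrite /Y -E0 -E1; apply: bcurve_mono.
Qed.

Lemma height_le u v : hle u v -> Y u <= Y v.
Proof.
case/hle_walk => s; elim: s u => [|e s IH] u /=; first by move/eqP->.
by case/andP=> /eqP<- /IH; apply: le_trans (ltW (bcurve_lt (inl e))).
Qed.

Lemma height_lt u v : hlt u v -> Y u < Y v.
Proof.
case/andP=> ne /hle_walk[[|e s]] /=; first by move=> E; rewrite E in ne.
case/andP=> /eqP<- sw; suff h z : walk (@etail _ P) (@ehead _ P) z s v -> hle z v.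
  exact: lt_le_trans (bcurve_lt (inl e)) (height_le (h _ sw)).
elim: s z {sw} => [|e' s IH] z /=; first by move/eqP->; exact: hle_refl.
by case/andP=> /eqP<- /IH; apply: hle_trans (hlt_le (edge_lt e')).
Qed.

Lemma bcurve_interior k t : 0 < t -> t < 1 ->
  Y (bsrc k) < (bcurve k t).2 /\ (bcurve k t).2 < Y (bdst k).
Proof.
case: (bcurve_up k) => _ [E0 [E1 _]] t0 t1; rewrite /Y -E0 -E1.
by split; apply: bcurve_mono => //; apply: ltW.
Qed.

Lemma bcurve_range k t : 0 <= t -> t <= 1 ->
  Y (bsrc k) <= (bcurve k t).2 /\ (bcurve k t).2 <= Y (bdst k).
Proof.
have lt := bcurve_lt k; case: (bcurve_up k) => _ [E0 [E1 _]].
rewrite le_eqVlt => /orP[/eqP<-|t0]; first by rewrite E0; split=> //; exact: ltW.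
rewrite le_eqVlt => /orP[/eqP->|t1]; first by rewrite E1; split=> //; exact: ltW.
by have [/ltW ? /ltW] := bcurve_interior k t0 t1.
Qed.

Lemma bcurve_interiorE k t : 0 <= t -> t <= 1 ->
  Y (bsrc k) < (bcurve k t).2 -> (bcurve k t).2 < Y (bdst k) -> 0 < t /\ t < 1.
Proof.
case: (bcurve_up k) => _ [E0 [E1 _]] t0 t1 a b; split; rewrite lt_neqAle ?t0 ?t1 andbT.
  by apply/eqP => E; move: a; rewrite -E E0 ltxx.
by apply/eqP => E; move: b; rewrite E E1 ltxx.
Qed.

(** For two Hasse edges this is planarity. The interior of an additional edge lies strictly to one
    side of everything else at its height, and its two ends are vertices, which no Hasse edge meets
    in its interior. *)
Lemma bcurve_disjoint k k' t t' : k != k' -> 0 < t -> t < 1 -> 0 <= t' -> t' <= 1 ->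
  bcurve k t <> bcurve k' t'.
Proof.
case: BD => -[_ [_ [ncr nv]]] [_ [_ [lft rgt]]] kk t0 t1 t0' t1' E.
have left_ z : (drawing_pts pos c `|` curve_img cR) z -> forall s, 0 < s -> s < 1 -> z <> cL s.
  move=> dz s s0 s1 zE; have := lft s _ z dz; rewrite s0 s1 zE => /(_ isT erefl).
  by rewrite ltxx.
have right_ z : (drawing_pts pos c `|` curve_img cL) z -> forall s, 0 < s -> s < 1 -> z <> cR s.
  move=> dz s s0 s1 zE; have := rgt s _ z dz; rewrite s0 s1 zE => /(_ isT erefl).
  by rewrite ltxx.
have img (f : R -> R * R) s : 0 <= s -> s <= 1 -> curve_img f (f s).
  by move=> s0 s1; exists s => //=; rewrite in_itv /= s0.
have imgc e s : 0 <= s -> s <= 1 -> drawing_pts pos c (c e s).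
  by move=> s0 s1; right; exists e => //; apply: img.
have bdry (b : bool) s : 0 <= s -> s <= 1 -> ~ (0 < s /\ s < 1) -> exists v, bcurve (inr b) s = pos v.
  case: (bcurve_up (inr b)) => _ [e0 [e1 _]].
  rewrite le_eqVlt => /orP[/eqP<- _ _|s0]; first by exists (bsrc (inr b)).
  rewrite le_eqVlt => /orP[/eqP-> _|s1]; first by exists (bdst (inr b)).
  by case.
case: k k' kk E => [e|b] [e'|b'] kk E.
- have [] := ncr e e' t t' _ _ _ E; rewrite ?t0' ?t1' ?ltW//.
    by move=> [] h _; move: t0 t1; rewrite h ltxx.
- have [[s0 s1]|ns] := pselect (0 < t' /\ t' < 1).
    case: b' {kk} E => /= E.
      by apply: (right_ _ _ _ s0 s1 E); left; apply: imgc; apply: ltW.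
    by apply: (left_ _ _ _ s0 s1 E); left; apply: imgc; apply: ltW.
  have [v vE] := bdry b' _ t0' t1' ns; rewrite vE in E.
  by apply: (nv e v t) E; rewrite t0.
- case: b {kk} E => /= E.
    by apply: (right_ _ _ _ t0 t1 (esym E)); left; apply: imgc.
  by apply: (left_ _ _ _ t0 t1 (esym E)); left; apply: imgc.
- case: b b' kk E => -[] //= _ E.
    by apply: (right_ _ _ _ t0 t1 (esym E)); right; apply: img.
  by apply: (left_ _ _ _ t0 t1 (esym E)); right; apply: img.
Qed.

Lemma bcurve_vertex k v t : 0 < t -> t < 1 -> bcurve k t <> pos v.
Proof.
case: BD => -[_ [_ [_ nv]]] [_ [_ [lft rgt]]] t0 t1; have t01 : 0 < t < 1 by rewrite t0.
case: k => [e|[]] /=; first exact: nv.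
  move=> E; have h : (drawing_pts pos c `|` curve_img cL) (pos v) by left; left; exists v.
  by have := rgt t t01 _ h; rewrite E ltxx => /(_ erefl).
move=> E; have h : (drawing_pts pos c `|` curve_img cR) (pos v) by left; left; exists v.
by have := lft t t01 _ h; rewrite E ltxx => /(_ erefl).
Qed.

Record graph_parametrization (g : bedge -> R -> R) : Prop := GraphParametrization {
  gp_drawing : drawing X Y bsrc bdst g (hbot P) (htop P);
  gp_curve : forall k t, 0 <= t -> t <= 1 -> g k (bcurve k t).2 = (bcurve k t).1;
  gp_onto : forall k y, Y (bsrc k) <= y -> y <= Y (bdst k) ->
    exists t, [/\ 0 <= t, t <= 1 & bcurve k t = (g k y, y)];
  gp_left : forall k y, Y (bsrc k) <= y -> y <= Y (bdst k) -> g (inr false) y <= g k y;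
  gp_right : forall k y, Y (bsrc k) <= y -> y <= Y (bdst k) -> g k y <= g (inr true) y }.

Lemma exists_graph_parametrization : exists g, graph_parametrization g.
Proof.
have [g gP] := choice (fun k => upcurve_graph (bcurve_up k)).
have onto k y : Y (bsrc k) <= y -> y <= Y (bdst k) ->
    exists t, [/\ 0 <= t, t <= 1 & bcurve k t = (g k y, y)].
  move=> a b; have [_ _ _ gc /(_ y a b)[t [t0 t1 tE]]] := gP k; exists t; split=> //.
  by rewrite [LHS]surjective_pairing -tE gc.
have interior k y : Y (bsrc k) < y -> y < Y (bdst k) ->
    exists t, [/\ 0 < t, t < 1 & bcurve k t = (g k y, y)].
  move=> a b; have [t [t0 t1 tE]] := onto k y (ltW a) (ltW b).
  by have [||t0' t1'] := @bcurve_interiorE k t t0 t1; rewrite ?tE//; exists t.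
have D : drawing X Y bsrc bdst g (hbot P) (htop P).
  split.
  - exact: bcurve_lt.
  - by move=> k; case: (gP k).
  - by move=> k; case: (gP k).
  - by move=> k; case: (gP k).
  - move=> u v h1 h2; case: BD => -[ij _] _; apply: ij.
    by rewrite (surjective_pairing (pos u)) (surjective_pairing (pos v)) -/(X u) -/(Y u) h1 h2.
  - move=> k k' y kk a b a' b' E.
    have [/andP[a1 b1]|] := boolP ((Y (bsrc k) < y) && (y < Y (bdst k))).
      have [t [t0 t1 tE]] := interior k y a1 b1; have [t' [t0' t1' tE']] := onto k' y a' b'.
      by exfalso; apply: (bcurve_disjoint kk t0 t1 t0' t1'); rewrite tE tE' E.
    rewrite negb_and -!leNgt => /orP[h|h]; [left|right]; lra.
  - move=> k v a b E; have [t [t0 t1 tE]] := interior k _ a b.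
    by apply: (bcurve_vertex (k := k) (v := v) t0 t1); rewrite tE E -surjective_pairing.
  - by move=> v /edge_out[e ev]; exists (inl e).
  - by move=> v /edge_in[e ev]; exists (inl e).
have botE v y : Y v <= y -> y = Y (hbot P) -> v = hbot P.
  move=> vy yE; apply/eqP/negPn/negP => vb.
  have : Y (hbot P) < Y v by apply: height_lt; rewrite /hlt eq_sym vb hle_bot.
  by rewrite -yE; lra.
have topE v y : y <= Y v -> y = Y (htop P) -> v = htop P.
  move=> vy yE; apply/eqP/negPn/negP => vb.
  have : Y v < Y (htop P) by apply: height_lt; rewrite /hlt vb hle_top.
  by rewrite -yE; lra.
(* The hypotheses on the additional edges speak only of their interior points. At the lowest and the
   highest height an edge can only be at 0^ or 1^, where it agrees with the additional edge. *)
have side (b : bool) k y : Y (bsrc k) <= y -> y <= Y (bdst k) ->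
   (exists t, [/\ 0 < t, t < 1 & bcurve (inr b) t = (g (inr b) y, y)]) \/ g k y = g (inr b) y.
  move=> a a'; have h1 : Y (hbot P) <= y by apply: le_trans a; apply: height_le; exact: hle_bot.
  have h2 : y <= Y (htop P) by apply: le_trans a' _; apply: height_le; exact: hle_top.
  move: h1 h2; rewrite le_eqVlt => /orP[/eqP E _|h1].
    have kb := botE _ _ a (esym E).
    by right; rewrite (d_lo D (k := k)) ?kb -?E// (d_lo D (k := inr b)) -?E.
  rewrite le_eqVlt => /orP[/eqP E|h2]; last by left; apply: interior.
  have kt := topE _ _ a' E.
  by right; rewrite (d_hi D (k := k)) ?kt ?E// (d_hi D (k := inr b)) ?E.
have in_pts b k y : Y (bsrc k) <= y -> y <= Y (bdst k) -> k != inr (~~ b) ->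
    (drawing_pts pos c `|` curve_img (bcurve (inr b))) (g k y, y).
  move=> a a' kb; have [t [t0 t1 tE]] := onto k y a a'.
  case: k a a' kb tE => [e|b'] a a' kb tE; rewrite -tE.
    by left; right; exists e => //; exists t => //=; rewrite in_itv /= t0.
  have -> : b' = b by case: b' b kb {tE a a'} => -[].
  by right; exists t => //=; rewrite in_itv /= t0.
case: BD => _ [_ [_ [lft rgt]]].
exists g; split=> //.
- by move=> k t t0 t1; have [_ _ _ -> //] := gP k.
- move=> k y a b; have [->//|kL] := eqVneq k (inr false).
  have [[t [t0 t1 tE]]|->//] := side false k y a b.
  have {}tE : cL t = (g (inr false) y, y) := tE.
  by have := lft t _ _ (in_pts true k y a b kL); rewrite t0 t1 tE => /(_ isT erefl)/ltW.
- move=> k y a b; have [->//|kL] := eqVneq k (inr true).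
  have [[t [t0 t1 tE]]|->//] := side true k y a b.
  have {}tE : cR t = (g (inr true) y, y) := tE.
  by have := rgt t _ _ (in_pts false k y a b kL); rewrite t0 t1 tE => /(_ isT erefl)/ltW.
Qed.

End Curves.

(** * Boundary walks of bounded faces *)

Section FaceWalks.
Variables (R : realType) (d : Order.disp_t) (P : finPOrderType d).
Variables (pos : hatP P -> R * R) (c : HEdge P -> R -> R * R) (cL cR : R -> R * R).
Hypothesis BD : bounded_drawing pos c cL cR.
Local Notation bcurve := (bcurve c cL cR).
Local Notation bounded_face := (bounded_face pos c cL cR).

Let X v := (pos v).1.
Let Y v := (pos v).2.

(** All that the flow computations need to know about a face. [fw_min] and [fw_max] identify a
    minimum or maximum once it is given, as the embedding does for faces with marked left boundary.
    By [fw_outerl] and [fw_outerr] an additional edge, which spans all heights, is alone on its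
    side. *)
Record face_walks (F : set (R * R)) (m M : hatP P) (l r : seq (bedge P)) : Prop := FaceWalks {
  fw_l : walk (@bsrc _ P) (@bdst _ P) m l M;
  fw_r : walk (@bsrc _ P) (@bdst _ P) m r M;
  fw_left : forall k, right_of (bcurve k) F <-> k \in l;
  fw_right : forall k, left_of (bcurve k) F <-> k \in r;
  fw_min : forall v, is_minF pos F v -> v = m;
  fw_max : forall v, is_maxF pos F v -> v = M;
  fw_uniql : uniq l;
  fw_uniqr : uniq r;
  fw_outerl : forall b k, inr b \in l -> k \in l -> k = inr b;
  fw_outerr : forall b k, inr b \in r -> k \in r -> k = inr b;
  fw_cRl : inr true \notin l;
  fw_cLr : inr false \notin r }.

Section Graph.
Variable g : bedge P -> R -> R.
Hypothesis GP : graph_parametrization pos c cL cR g.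
Let D := gp_drawing GP.

Lemma right_of_side k F : right_of (bcurve k) F <-> right_side Y (@bsrc _ P) (@bdst _ P) g k F.
Proof.
split=> [[t [/andP[t0 t1] [e e0 eP]]]|[y [a b [e e0 eP]]]].
  have [a b] := bcurve_interior BD k t0 t1.
  exists (bcurve k t).2; split=> //; exists e => // s s0 se.
  by rewrite (gp_curve GP) ?ltW//; apply: eP; rewrite s0.
have [t [t0 t1 tE]] := gp_onto GP (ltW a) (ltW b).
have [||t0' t1'] := bcurve_interiorE BD (k := k) t0 t1; rewrite ?tE//.
exists t; rewrite t0' t1' tE; split=> //; exists e => // s /andP[s0 se].
exact: eP.
Qed.

Lemma left_of_side k F : left_of (bcurve k) F <-> left_side Y (@bsrc _ P) (@bdst _ P) g k F.
Proof.
split=> [[t [/andP[t0 t1] [e e0 eP]]]|[y [a b [e e0 eP]]]].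
  have [a b] := bcurve_interior BD k t0 t1.
  exists (bcurve k t).2; split=> //; exists e => // s s0 se.
  by rewrite (gp_curve GP) ?ltW//; apply: eP; rewrite s0.
have [t [t0 t1 tE]] := gp_onto GP (ltW a) (ltW b).
have [||t0' t1'] := bcurve_interiorE BD (k := k) t0 t1; rewrite ?tE//.
exists t; rewrite t0' t1' tE; split=> //; exists e => // s /andP[s0 se].
exact: eP.
Qed.

Lemma complement_skeleton :
  complementH pos c cL cR = ~` skeleton Y (@bsrc _ P) (@bdst _ P) g.
Proof.
rewrite /complementH; congr (~` _); apply/seteqP.
have img k z : curve_img (bcurve k) z -> skeleton Y (@bsrc _ P) (@bdst _ P) g z.
  move=> [t] /=; rewrite in_itv /= => /andP[t0 t1] <-.
  have [a b] := bcurve_range BD k t0 t1.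
  by exists k; rewrite (gp_curve GP k t0 t1).
split=> [z [[[[v _ <-]|[e _ ez]]|]|]|[x y] [k [/= a b ->]]].
- rewrite (surjective_pairing (pos v)).
  exact: (vertex_skeleton D).
- exact: (img (inl e)).
- exact: (img (inr false)).
- exact: (img (inr true)).
have [t [t0 t1 <-]] := gp_onto GP a b.
have tI : `[0, 1]%classic t by rewrite /= in_itv /= t0.
case: k {a b} => [e|[]]; last 2 first.
- by right; exists t.
- by left; right; exists t.
- by left; left; right; exists e => //; exists t.
Qed.

Lemma cell_face_walks m M l r : cell X Y (@bsrc _ P) (@bdst _ P) g m M l r ->
  face_walks (region X Y (@bsrc _ P) g m M l r) m M l r.
Proof.
move=> C; have wl := cell_l C; have wr := cell_r C.
have bt : hbot P != htop P by [].
have outer s b k : walk (@bsrc _ P) (@bdst _ P) m s M -> inr b \in s -> k \in s -> k = inr b.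
  move=> sw bs ks; have lt := d_up D k.
  have h1 := height_le BD (hle_bot (bsrc k)); have h2 := height_le BD (hle_top (bdst k)).
  apply: (walk_range_disjoint D (y := (Y (bsrc k) + Y (bdst k)) / 2) sw ks bs); rewrite /=;
    rewrite /Y in lt *; lra.
have vertex v : on_bd pos (region X Y (@bsrc _ P) g m M l r) v -> hle m v /\ hle v M.
  rewrite /on_bd (surjective_pairing (pos v)) => /(closure_region_vertex D C bt)[k [ks vk]].
  have [s sw {}ks] : exists2 s, walk (@bsrc _ P) (@bdst _ P) m s M & k \in s.
    by case/orP: ks; [exists l|exists r].
  have [s1 [s2 [_ /bwalk_le w1 /bwalk_le w2]]] := walk_mem sw ks.
  have kk := hlt_le (bedge_lt k).
  case: vk => ->; split=> //; [exact: hle_trans w2|exact: hle_trans w1 _].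
have bm : on_bd pos (region X Y (@bsrc _ P) g m M l r) m.
  by rewrite /on_bd (surjective_pairing (pos m)); refine (closure_region_m D C).
have bM : on_bd pos (region X Y (@bsrc _ P) g m M l r) M.
  by rewrite /on_bd (surjective_pairing (pos M)); refine (closure_region_M D C).
have [y [my yM]] : exists y, Y m < y /\ y < Y M.
  by exists ((Y m + Y M) / 2); have := cell_lt C; split; lra.
have by_ : Y (hbot P) < y by apply: le_lt_trans my; exact: height_le BD _ _ (hle_bot m).
have yt : y < Y (htop P) by apply: lt_le_trans yM _; exact: height_le BD _ _ (hle_top M).
split=> //.
- by move=> k; rewrite right_of_side; exact: (right_sideP D C).
- by move=> k; rewrite left_of_side; exact: (left_sideP D).
- by move=> v [bv vmin]; apply: hle_anti (vmin _ bm) (vertex _ bv).1.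
- by move=> v [bv vmax]; apply: hle_anti (vertex _ bv).2 (vmax _ bM).
- exact: (walk_uniq D wl).
- exact: (walk_uniq D wr).
- by move=> b k; apply: outer.
- by move=> b k; apply: outer.
(* With the right additional edge on the left side, the right walk would have to run beyond it. *)
- apply/negP => cl; have := cell_in C my yM.
  rewrite (gwalk_on D wl cl) ?(ltW by_) ?(ltW yt)//.
  have [j [jr j1 j2]] := gwalk_at wr (ltW my) yM.
  rewrite (gwalk_on D wr jr j1 (ltW j2)) ltNge => /negP; apply.
  exact: (gp_right GP) j1 (ltW j2).
- apply/negP => cr; have := cell_in C my yM.
  rewrite (gwalk_on D wr cr) ?(ltW by_) ?(ltW yt)//.
  have [j [jl j1 j2]] := gwalk_at wl (ltW my) yM.
  rewrite (gwalk_on D wl jl j1 (ltW j2)) ltNge => /negP; apply.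
  exact: (gp_left GP) j1 (ltW j2).
Qed.

Lemma cell_bounded_face m M l r : cell X Y (@bsrc _ P) (@bdst _ P) g m M l r ->
  bounded_face (region X Y (@bsrc _ P) g m M l r).
Proof.
move=> C; split; last exact: (region_bounded D C).
by have [z [nz E]] := cell_component D C; exists z; rewrite complement_skeleton.
Qed.

End Graph.

Lemma bounded_face_walks F : bounded_face F -> exists m M l r, face_walks F m M l r.
Proof.
have [g GP] := exists_graph_parametrization BD; have D := gp_drawing GP.
rewrite /Defs.bounded_face (complement_skeleton GP) => -[[z [nz ->]] bd].
have [m [M [l [r [C ->]]]]] := bounded_component_cell D (kL := inr false) (kR := inr true)
  erefl erefl erefl erefl (gp_left GP) (gp_right GP) nz bd.
by exists m, M, l, r; exact: cell_face_walks GP _ _ _ _ C.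
Qed.

Lemma face_right_of e : exists F, bounded_face F /\ right_of (c e) F.
Proof.
have [g GP] := exists_graph_parametrization BD; have D := gp_drawing GP.
have [//|m [M [l [r [C el]]]]] := cell_right_of_edge D (kL := inr false) (kR := inr true)
  erefl erefl erefl (gp_right GP) (k := inl e).
exists (region X Y (@bsrc _ P) g m M l r); split; first exact: (cell_bounded_face GP C).
exact/(fw_left (cell_face_walks GP C) (inl e)).
Qed.

Lemma above_finite (s : seq R) (b : R) : (forall x, x \in s -> x < b) ->
  exists2 y, y < b & forall x, x \in s -> x < y.
Proof.
elim: s => [|x s IH] sb; first by exists (b - 1) => //; lra.
have [|y yb ys] := IH; first by move=> z zs; apply: sb; rewrite inE zs orbT.
have xb : x < b by apply: sb; rewrite mem_head.
have [m1 m2] : y <= Num.max x y /\ x <= Num.max x y by rewrite !le_max !lexx orbT.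
have mb : Num.max x y < b by rewrite gt_max xb.
exists ((Num.max x y + b) / 2); first by lra.
by move=> z; rewrite inE => /predU1P[->|/ys]; lra.
Qed.

(* For an incoming edge [e] of [p] that is not the rightmost one, the face to
   the right of [e] has maximum [p], and its right boundary reaches [p] along an
   edge further to the right. *)
Lemma incoming_constant (T : Type) (val : HEdge P -> T) p :
  (forall F m l r e e', bounded_face F ->
     face_walks F m p (rcons l (inl e)) (rcons r (inl e')) -> val e = val e') ->
  forall e e', ehead e = p -> ehead e' = p -> val e = val e'.
Proof.
move=> H; have [g GP] := exists_graph_parametrization BD; have D := gp_drawing GP.
pose E := [pred e : HEdge P | ehead e == p].
(* At height [h], just below [p], all incoming edges of [p] are present and are linearly ordered by
   abscissa. The induction is on the number of those to the right of [e]. *)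
have [h hp hE] : exists2 h, h < Y p & forall e, E e -> Y (etail e) < h.
  have [x|h hp hs] := @above_finite [seq Y (etail e) | e <- enum E] (Y p).
    by move=> /mapP[e]; rewrite mem_enum => /eqP <- ->; exact: (d_up D (inl e)).
  by exists h => // e Ee; apply: hs; apply/map_f; rewrite mem_enum.
suff main e0 : E e0 -> exists emax, forall e, E e -> val e = val emax.
  move=> e e' /eqP Ee /eqP Ee'; have [em emP] := main e Ee.
  by rewrite (emP e Ee) (emP e' Ee').
move=> Ee0; case: (@arg_maxP _ _ _ e0 E (fun e => g (inl e) h) Ee0) => em Em emax.
exists em => e; have [n] := ubnP #|[pred e' | E e' & g (inl e) h < g (inl e') h]|.
elim: n e => // n IH e cn Ee; have [->//|ne] := eqVneq e em.
have range f : E f -> Y (etail f) < h /\ h < Y (ehead f).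
  by move=> Ef; split; [exact: hE|rewrite (eqP Ef)].
have nc f f' : f != f' -> E f -> E f' -> g (inl f) h <> g (inl f') h.
  move=> ff Ef Ef' eqg; have [a b] := range f Ef; have [a' b'] := range f' Ef'.
  have ff' : inl f != inl f' :> bedge P by apply: contraNneq ff => -[->].
  by have [h1|h1] := d_nc D ff' (ltW a) (ltW b) (ltW a') (ltW b') eqg;
    rewrite h1 /= ltxx in a b.
have lt : g (inl e) h < g (inl em) h.
  by rewrite lt_neqAle (emax e Ee : _ <= _) andbT; apply/eqP; apply: nc.
have [//|m [M [l [r [C el]]]]] := cell_right_of_edge D (kL := inr false) (kR := inr true)
  erefl erefl erefl (gp_right GP) (k := inl e).
have [a b] := range e Ee; have [a' b'] := range em Em.
have dd : bdst (inl em) = bdst (inl e) by rewrite /= (eqP Em) (eqP Ee).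
have [l1 [r1 [e2 [Mp lE rE lt2]]]] := cell_max_incoming D C el dd a b a' lt.
have FW := cell_face_walks GP C; have BF := cell_bounded_face GP C.
have hbot_lt : Y (hbot P) < h by apply: le_lt_trans (height_le BD (hle_bot _)) a.
(* [e2] is strictly to the right of [e] and not to the right of [em] at height [h], so it is neither
   of the additional edges. *)
have [e2' e2E] : exists e2', e2 = inl e2'.
  case: e2 rE lt2 => [e2'|b2] rE lt2; first by exists e2'.
  have [h1 /(_ a') h2] := lt2 h a hbot_lt b; exfalso.
  have top_le : h <= Y (htop P) by apply: le_trans (ltW b) (height_le BD (hle_top _)).
  case: b2 {rE lt2} h1 h2 => h1 h2.
    have h3 := gp_right GP (k := inl em) (ltW a') (ltW b').
    have eqg : g (inl em) h = g (inr true) h by apply/eqP; rewrite eq_le h3.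
    have [//|h4|h4] := d_nc D (k := inl em) (k' := inr true) _ (ltW a') (ltW b') (ltW hbot_lt) top_le eqg;
      by rewrite h4 /= ltxx in a' b'.
  by have := gp_left GP (k := inl e) (ltW a) (ltW b); lra.
subst e2; move: (FW) (BF); rewrite lE rE Mp /= (eqP Ee) => FW' BF'.
rewrite (H _ _ _ _ _ _ BF' FW').
have Ee2 : E e2' by have [_ /= /eqP] := walk_rconsE (fw_r FW').
have [a2 b2] := range e2' Ee2.
have {lt2}[lt2 _] := lt2 h a a2 b.
apply: IH => //; rewrite -ltnS; apply: leq_trans cn; rewrite ltnS; apply: proper_card.
apply/properP; split; last by exists e2'; rewrite !inE ?ltxx ?andbF//; apply/andP.
by apply/fintype.subsetP => f; rewrite !inE => /andP[-> /(lt_trans lt2)].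
Qed.

End FaceWalks.

(** * A criterion for integral equivalence *)

(** An affine combination of points of [T] is lifted by choosing preimages in [S] and keeping the
    coefficients; affinity makes it a preimage, and integrality is reflected by [phi]. *)
Lemma integrally_equivalent_of_injective (R : realType) (I J : Type)
    (S : set (I -> R)) (T : set (J -> R)) (phi : (I -> R) -> (J -> R)) :
  affine_map phi -> injective phi -> (forall x, S x -> T (phi x)) ->
  (forall y, T y -> exists2 x, S x & phi x = y) ->
  (forall x, int_point x <-> int_point (phi x)) -> integrally_equivalent S T phi.
Proof.
move=> aff inj ST TS int; split=> //; split; first by split=> //; split=> // x y _ _ /inj.
split; last split.
- move=> _ [[n [cf [xs [Sxs [cf1 ->]]]]] /int ix]; split=> //.
  exists n, cf, (fun i => phi (xs i)); split; first by move=> i; apply: ST.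
  by split=> //; exact: aff.
- by move=> x y _ _ /inj.
- move=> y [[n [cf [ys [Tys [cf1 yE]]]]] iy].
  have [xs xsP] := choice (fun i => let: ex_intro2 x a b := TS _ (Tys i) in
    ex_intro (fun x => S x /\ phi x = ys i) x (conj a b)).
  have E : phi (fun k => \sum_(i < n) cf i * xs i k) = y.
    by rewrite aff// yE; apply: funext => k; apply: eq_bigr => i _; rewrite (xsP i).2.
  exists (fun k => \sum_(i < n) cf i * xs i k) => //; split; last by apply/int; rewrite E.
  by exists n, cf, xs; split=> // i; exact: (xsP i).1.
Qed.

(** * Walks of Hasse edges *)

Section HasseWalks.
Variables (d : Order.disp_t) (P : finPOrderType d).
Local Notation hwalk := (walk (@etail _ P) (@ehead _ P)).
Local Notation inlh := (@inl (HEdge P) bool).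

Lemma bwalk_inl u s w : walk (@bsrc _ P) (@bdst _ P) u (map inlh s) w = hwalk u s w.
Proof. by elim: s u => //= e s IH u; rewrite IH. Qed.

Lemma hwalk_le u s w : hwalk u s w -> hle u w.
Proof. by rewrite -bwalk_inl; exact: bwalk_le. Qed.

Lemma hwalk_lt u s w : hwalk u s w -> s != [::] -> hlt u w.
Proof.
case: s => // e s /walk_consE[-> /hwalk_le ew] _.
rewrite /hlt (hle_trans (hlt_le (edge_lt e)) ew) andbT; apply/eqP => E.
by move: (hlt_nle (edge_lt e)); rewrite E ew.
Qed.

Lemma hwalk_mem_le u s w e : hwalk u s w -> e \in s -> hle u (etail e) /\ hle (ehead e) w.
Proof. by move=> h /(walk_mem h)[s1 [s2 [_ /hwalk_le ? /hwalk_le]]]. Qed.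

Lemma hwalk_vertex_le u s w e v : hwalk u s w -> e \in s -> v = etail e \/ v = ehead e ->
  hle u v /\ hle v w.
Proof.
move=> h /(hwalk_mem_le h)[h1 h2]; have h3 := hlt_le (edge_lt e).
by case=> ->; split=> //; [exact: hle_trans h2|exact: hle_trans h3].
Qed.

Lemma hwalk_between s m M u w e e' : hwalk m s M -> hlt u w ->
  e \in s -> u = etail e \/ u = ehead e -> e' \in s -> w = etail e' \/ w = ehead e' ->
  exists a b c, [/\ s = a ++ b ++ c, hwalk m a u, hwalk u b w & hwalk w c M].
Proof.
move=> sw uw es ue es' we; have [a [t [sE aw tw]]] := walk_split sw es ue.
move: es'; rewrite sE mem_cat => /orP[e'a|e't].
  by have [_ wu] := hwalk_vertex_le aw e'a we; move: (hlt_nle uw); rewrite wu.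
have [b [c [tE bw cw]]] := walk_split tw e't we.
by exists a, b, c; rewrite tE.
Qed.

(** The order test used in the conservation law at the vertices [s^F_m] cuts out exactly the stretch
    of the left boundary from [u] to [w]. *)
Lemma hwalk_filter m M u w a b c : hwalk m a u -> hwalk u b w -> hwalk w c M ->
  (fun e => (e \in a ++ b ++ c) && hle u (etail e) && hle (ehead e) w) =1 mem b.
Proof.
move=> aw bw cw e /=; rewrite !mem_cat.
apply/idP/idP => [/andP[/andP[/or3P[ea|//|ec] h1] h2]|eb].
- have [_ h3] := hwalk_mem_le aw ea; have := hlt_nle (edge_lt e).
  by rewrite (hle_trans h3 h1).
- have [h3 _] := hwalk_mem_le cw ec; have := hlt_nle (edge_lt e).
  by rewrite (hle_trans h2 h3).
- by have [-> ->] := hwalk_mem_le bw eb; rewrite eb orbT.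
Qed.

Lemma all_inl (s : seq (bedge P)) : (forall b, inr b \notin s) -> exists t, s = map inlh t.
Proof.
elim: s => [|k s IH] h; first by exists [::].
have [b|t ->] := IH; first by have := h b; rewrite inE negb_or => /andP[].
case: k h => [e|b] h; first by exists (e :: t).
by have := h b; rewrite mem_head.
Qed.

End HasseWalks.

(** * [Gamma] as the gradient of a potential *)

Section Potential.
Variables (R : realType) (d : Order.disp_t) (P : finPOrderType d).
Variables (A : {set P}) (lam : P -> R).
Local Notation hwalk := (walk (@etail _ P) (@ehead _ P)).

Lemma lam_min_le a : a \in A -> lam_min A lam <= lam a.
Proof.
rewrite /lam_min; case: pickP => [a0 _|/(_ a)->//] aA; exact: bigmin_le_cond.
Qed.

Lemma lam_max_ge a : a \in A -> lam a <= lam_max A lam.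
Proof.
rewrite /lam_max; case: pickP => [a0 _|/(_ a)->//] aA; exact: le_bigmax_cond.
Qed.

Lemma lam_min_le_max : lam_min A lam <= lam_max A lam.
Proof.
case: (pickP (mem A)) => [a aA|none]; first exact: le_trans (lam_min_le aA) (lam_max_ge aA).
by rewrite /lam_min /lam_max; case: pickP => // a aA; have := none a; rewrite /= aA.
Qed.

Hypothesis lamZ : forall a, a \in A -> exists z : int, lam a = z%:~R.

Lemma lam_min_int : exists z : int, lam_min A lam = z%:~R.
Proof.
rewrite /lam_min; case: pickP => [a0 a0A|_]; last by exists 0.
apply: (big_ind (fun y : R => exists z : int, y = z%:~R)) => //; first exact: lamZ.
by move=> x y [z xz] [t yt]; rewrite /Num.min; case: ifP; [exists z|exists t].
Qed.

Lemma lam_max_int : exists z : int, lam_max A lam = z%:~R.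
Proof.
rewrite /lam_max; case: pickP => [a0 a0A|_]; last by exists 0.
apply: (big_ind (fun y : R => exists z : int, y = z%:~R)) => //; first exact: lamZ.
by move=> x y [z xz] [t yt]; rewrite /Num.max; case: ifP; [exists t|exists z].
Qed.

Lemma Gamma_hwalk x u s w : hwalk u s w ->
  \sum_(e <- s) Gamma A lam x e = xhat A lam x w - xhat A lam x u.
Proof. exact: (walk_telescope (xhat A lam x)). Qed.

Lemma xhat_Gamma x v s : hwalk (hbot P) s v ->
  xhat A lam x v = lam_min A lam + \sum_(e <- s) Gamma A lam x e.
Proof. by move/(Gamma_hwalk x) => ->; rewrite addrC subrK. Qed.

(** The potential at 0^ is fixed by [A] and [lam] alone, so the differences along a walk from 0^
    determine every value, also outside the polytope. *)
Lemma Gamma_inj : injective (Gamma A lam).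
Proof.
move=> x y E; apply: funext => p; have [s sw] := hle_walk (hle_bot (inr p)).
by have := xhat_Gamma x sw; rewrite E -(xhat_Gamma y sw).
Qed.

Lemma Gamma_affine : affine_map (Gamma A lam).
Proof.
move=> n cf xs cf1; have xh v : xhat A lam (fun k => \sum_(i < n) cf i * xs i k) v =
    \sum_(i < n) cf i * xhat A lam (xs i) v.
  by case: v => [[]|p] //=; rewrite -mulr_suml cf1 mul1r.
apply: funext => e; rewrite /Gamma !xh -sumrB.
by apply: eq_bigr => i _; rewrite mulrBr.
Qed.

Lemma Gamma_int x : int_point x <-> int_point (Gamma A lam x).
Proof.
split=> [ix e|iG p].
  have xh v : exists z : int, xhat A lam x v = z%:~R.
    by case: v => [[]|p] /=; [exact: lam_max_int|exact: lam_min_int|exact: ix].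
  have [z zE] := xh (ehead e); have [t tE] := xh (etail e).
  by exists (z - t); rewrite /Gamma zE tE intrB.
have [s sw] := hle_walk (hle_bot (inr p)).
have := xhat_Gamma x sw => /= ->.
have [z ->] := lam_min_int.
suff [t ->] : exists t : int, \sum_(e <- s) Gamma A lam x e = t%:~R.
  by exists (z + t); rewrite intrD.
apply: (big_ind (fun y : R => exists z : int, y = z%:~R)); first by exists 0.
  by move=> a b [i ->] [j ->]; exists (i + j); rewrite intrD.
by move=> e _; exact: iG.
Qed.

Hypothesis MP : marked_poset A lam.

Lemma lamhatE x v : marked_order_polytope A lam x -> hmarked A v ->
  lamhat A lam v = xhat A lam x v.
Proof. by case=> _ xA; case: v => [[]|p] //= /xA. Qed.

Lemma Gamma_ge0 x e : marked_order_polytope A lam x -> 0 <= Gamma A lam x e.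
Proof.
case=> mono xA; case: MP => minA [maxA _]; rewrite subr_ge0.
have := valP e; rewrite /etail /ehead /hcover; case: (val e) => u v /= /andP[uv /existsPn cov].
case: u uv cov => [[]|p] uv cov; case: v uv cov => [[]|q] uv cov //=.
(* 1^ covers 0^ only when [P] is empty; both values are then the default 0. *)
- by rewrite lam_min_le_max.
(* An element covering 0^ is minimal in [P], hence marked; dually below for an element covered by
   1^. *)
- have qA : q \in A.
    apply: minA => r; apply/negP => rq; have := cov (inr r).
    rewrite /hlt /= (ltW rq) andbT; case/negP.
    by apply/eqP => -[E]; rewrite E ltxx in rq.
  by rewrite xA// lam_min_le.
- have pA : p \in A.
    apply: maxA => r; apply/negP => pr; have := cov (inr r).
    rewrite /hlt /= (ltW pr) !andbT; case/negP.
    by apply/eqP => -[E]; rewrite E ltxx in pr.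
  by rewrite xA// lam_max_ge.
- apply: mono; case/andP: uv => /= ne pq; rewrite lt_neqAle pq andbT.
  by apply: contraNneq ne => ->.
Qed.

End Potential.

(** * Flows and potentials *)

Section Flow.
Variables (R : realType) (d : Order.disp_t) (P : finPOrderType d).
Variables (A : {set P}) (lam : P -> R).
Variables (pos : hatP P -> R * R) (c : HEdge P -> R -> R * R) (cL cR : R -> R * R).
Hypothesis BSP : bounded_sp_embedding pos c cL cR A.
Local Notation hwalk := (walk (@etail _ P) (@ehead _ P)).
Local Notation inlh := (@inl (HEdge P) bool).
Local Notation bounded_face := (bounded_face pos c cL cR).
Local Notation face_walks := (face_walks pos c cL cR).
Local Notation lamh := (lamhat A lam).
Let BD : bounded_drawing pos c cL cR := BSP.1.

Lemma left_bd_eltP F m M l r v : face_walks F m M l r ->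
  left_bd_elt c cL F v <-> exists2 k, k \in l & v = bsrc k \/ v = bdst k.
Proof.
move=> FW; split=> [[[e [el ve]]|[Ll vb]]|[[e|[]] kl vk]].
- by exists (inl e) => //; apply/(fw_left FW (inl e)).
- by exists (inr false) => //; apply/(fw_left FW (inr false)).
- by left; exists e; split=> //; apply/(fw_left FW (inl e)).
- by have := fw_cRl FW; rewrite kl.
- by right; split=> //; apply/(fw_left FW (inr false)).
Qed.

Lemma not_FL_inl F m M l r : bounded_face F -> face_walks F m M l r ->
  ~ is_FL pos c cL cR F -> exists l', l = map inlh l'.
Proof.
move=> bF FW nFL; apply: all_inl => -[]; first exact: fw_cRl FW.
by apply/negP => /(fw_left FW (inr false)) h; apply: nFL.
Qed.

Lemma not_FR_inl F m M l r : bounded_face F -> face_walks F m M l r ->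
  ~ is_FR pos c cL cR F -> exists r', r = map inlh r'.
Proof.
move=> bF FW nFR; apply: all_inl => -[]; last exact: fw_cLr FW.
by apply/negP => /(fw_right FW (inr true)) h; apply: nFR.
Qed.

(** The left boundary of F_L contains 0^, which is always marked. *)
Lemma unmarked_not_FL F : bounded_face F -> ~ left_bd_marked c cL A F -> ~ is_FL pos c cL cR F.
Proof.
by move=> bF nm [_ h]; apply: nm; exists (hbot P); split=> //; right; split=> //; left.
Qed.

Let inlh_inj : injective inlh. Proof. by move=> e e' []. Qed.

Lemma on_left_bdE F m M l r e : face_walks F m M (map inlh l) r ->
  `[< on_left_bd c F e >] = (e \in l).
Proof.
move=> FW; rewrite -(mem_map inlh_inj).
by apply/asboolP/idP => /(fw_left FW (inl e)).
Qed.

Lemma on_right_bdE F m M l r e : face_walks F m M l (map inlh r) ->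
  `[< on_right_bd c F e >] = (e \in r).
Proof.
move=> FW; rewrite -(mem_map inlh_inj).
by apply/asboolP/idP => /(fw_right FW (inl e)).
Qed.

Lemma sum_left f F m M l r : face_walks F m M (map inlh l) r ->
  \sum_(e : HEdge P | `[< on_left_bd c F e >]) f e = \sum_(e <- l) f e :> R.
Proof.
move=> FW; rewrite big_uniq; last by rewrite -(map_inj_uniq inlh_inj) (fw_uniql FW).
by apply: eq_bigl => e; rewrite (on_left_bdE _ FW).
Qed.

Lemma sum_right f F m M l r : face_walks F m M l (map inlh r) ->
  \sum_(e : HEdge P | `[< on_right_bd c F e >]) f e = \sum_(e <- r) f e :> R.
Proof.
move=> FW; rewrite big_uniq; last by rewrite -(map_inj_uniq inlh_inj) (fw_uniqr FW).
by apply: eq_bigl => e; rewrite (on_right_bdE _ FW).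
Qed.

Lemma sum_between f F m M a b1 b2 u w r : face_walks F m M (map inlh (a ++ b1 ++ b2)) r ->
  hwalk m a u -> hwalk u b1 w -> hwalk w b2 M ->
  \sum_(e : HEdge P | `[< on_left_bd c F e >] && hle u (etail e) && hle (ehead e) w) f e =
  \sum_(e <- b1) f e :> R.
Proof.
move=> FW aw bw cw; have := fw_uniql FW; rewrite (map_inj_uniq inlh_inj) !cat_uniq.
move=> /and3P[_ _ /and3P[ub _ _]]; rewrite big_uniq//.
by apply: eq_bigl => e; rewrite (on_left_bdE _ FW) (hwalk_filter aw bw cw).
Qed.

Lemma marked_min_max F m M l r : bounded_face F -> face_walks F m M l r ->
  left_bd_marked c cL A F -> [/\ is_minF pos F m, hmarked A m, is_maxF pos F M & hmarked A M].
Proof.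
move=> bF FW mF; have [[m' [mm ma]] [M' [MM Ma]]] := BSP.2 F bF mF.
by have mE := fw_min FW mm; have ME := fw_max FW MM; subst m' M'.
Qed.

Lemma left_vertex F m M l r v : face_walks F m M (map inlh l) r -> left_bd_elt c cL F v ->
  exists2 e, e \in l & v = etail e \/ v = ehead e.
Proof. by move=> FW /(left_bd_eltP _ FW)[_ /mapP[e el ->] ve]; exists e. Qed.

Lemma left_vertexI F m M l r v e : face_walks F m M (map inlh l) r -> e \in l ->
  v = etail e \/ v = ehead e -> left_bd_elt c cL F v.
Proof.
by move=> FW el ve; apply/(left_bd_eltP _ FW); exists (inl e) => //; apply: map_f.
Qed.

Lemma Gamma_flow x : marked_poset A lam -> marked_order_polytope A lam x ->
  flow_polytope pos c cL cR A lam (Gamma A lam x).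
Proof.
move=> MP Ox; split; first by move=> e; exact: Gamma_ge0.
split; [|split].
- move=> F bF nFR nm; have [m [M [l [r FW]]]] := bounded_face_walks BD bF.
  have [l' lE] := not_FL_inl bF FW (unmarked_not_FL bF nm).
  have [r' rE] := not_FR_inl bF FW nFR; rewrite lE rE in FW.
  rewrite (sum_left _ FW) (sum_right _ FW).
  have := fw_l FW; have := fw_r FW; rewrite !bwalk_inl => wr wl.
  by rewrite (Gamma_hwalk _ _ _ wl) (Gamma_hwalk _ _ _ wr) subrr.
- move=> F bF nFR mF m' M' mm' MM'; have [m [M [l [r FW]]]] := bounded_face_walks BD bF.
  have [r' rE] := not_FR_inl bF FW nFR; rewrite rE in FW.
  have [_ ma _ Ma] := marked_min_max bF FW mF.
  rewrite (fw_min FW mm') (fw_max FW MM') (sum_right _ FW) sub0r.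
  have := fw_r FW; rewrite bwalk_inl => wr.
  by rewrite (Gamma_hwalk _ _ _ wr) !(lamhatE Ox).
- move=> F bF nFL mF w u [wF [wa [uF [ua [uw _]]]]].
  have [m [M [l [r FW]]]] := bounded_face_walks BD bF.
  have [l' lE] := not_FL_inl bF FW nFL; rewrite lE in FW.
  have [e el ue] := left_vertex FW uF; have [e' el' we] := left_vertex FW wF.
  have := fw_l FW; rewrite bwalk_inl => wl.
  have [a [b [b' [l'E aw bw cw]]]] := hwalk_between wl uw el ue el' we.
  rewrite l'E in FW; rewrite (sum_between _ FW aw bw cw).
  by rewrite (Gamma_hwalk _ _ _ bw) !(lamhatE Ox).
Qed.

Section Inverse.
Variable f : HEdge P -> R.
Hypothesis Ff : flow_polytope pos c cL cR A lam f.

(** Conservation at the vertices [s^F_m] covers consecutive marked vertices. If [u] and [w] are not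
    consecutive, a marked vertex between them splits [b1] into two shorter walks whose sums add
    up. *)
Lemma marked_left_sum F m M a b1 b2 u w r : bounded_face F ->
  face_walks F m M (map inlh (a ++ b1 ++ b2)) r -> left_bd_marked c cL A F ->
  hwalk m a u -> hwalk u b1 w -> hwalk w b2 M -> hmarked A u -> hmarked A w ->
  \sum_(e <- b1) f e = lamh w - lamh u.
Proof.
move=> bF FW mF; have [n] := ubnP (size b1); elim: n a b1 b2 u w FW => // n IH a b1 b2 u w FW.
move=> sb aw bw cw ua wa; have [b0|b0] := eqVneq b1 [::].
  by move: bw; rewrite b0 => /eqP->; rewrite big_nil subrr.
have uw := hwalk_lt bw b0.
have nFL : ~ is_FL pos c cL cR F.
  by move=> [_ /(fw_left FW (inr false)) /mapP[]].
have [uF wF] : left_bd_elt c cL F u /\ left_bd_elt c cL F w.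
  case: b1 b0 bw FW {sb uw} => // e b1 _ bw FW; split.
    apply: (left_vertexI (e := e) FW); first by rewrite !mem_cat mem_head orbT.
    by left; case: (walk_consE bw).
  case/lastP: (b1) bw FW => [|b1' e'] bw FW.
    apply: (left_vertexI (e := e) FW); first by rewrite !mem_cat mem_head orbT.
    by right; case: (walk_consE bw) => _ /= /eqP.
  apply: (left_vertexI (e := e') FW); first by rewrite !mem_cat inE mem_rcons mem_head !orbT.
  by right; have [_] := walk_rconsE (s := e :: b1') bw.
have [[v [vF [va [uv vw]]]]|no] :=
    pselect (exists v, left_bd_elt c cL F v /\ hmarked A v /\ hlt u v /\ hlt v w).
  have [e el ve] := left_vertex FW vF; move: el; rewrite !mem_cat => /or3P[ea|eb|ec].
  - by have [_ vu] := hwalk_vertex_le aw ea ve; move: (hlt_nle uv); rewrite vu.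
  - have [s1 [s2 [bE w1 w2]]] := walk_split bw eb ve.
    have s10 : s1 != [::] by apply: contraTneq uv => E; move: w1; rewrite E => /eqP->; rewrite /hlt eqxx.
    have s20 : s2 != [::] by apply: contraTneq vw => E; move: w2; rewrite E => /eqP->; rewrite /hlt eqxx.
    move: sb; rewrite bE size_cat big_cat /= => sb.
    have [z1 z2] : (size s1 < n)%N /\ (size s2 < n)%N.
      move: s10 s20 sb; rewrite -!size_eq0 -!lt0n ltnS => q1 q2 sb.
      split; apply: leq_trans sb.
        by rewrite -[X in (X < _)%N]addn0 ltn_add2l.
      by rewrite -[X in (X < _)%N]add0n ltn_add2r.
    have sum1 : \sum_(e0 <- s1) f e0 = lamh v - lamh u.
      apply: (IH a s1 (s2 ++ b2)) => //; first by rewrite bE -catA in FW.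
      exact: walk_cat w2 cw.
    have sum2 : \sum_(e0 <- s2) f e0 = lamh w - lamh v.
      apply: (IH (a ++ s1) s2 b2) => //; first by rewrite bE -!catA in FW *.
      exact: walk_cat aw w1.
    by rewrite sum1 sum2 addrC addrA subrK.
  - by have [wv _] := hwalk_vertex_le cw ec ve; move: (hlt_nle vw); rewrite wv.
case: Ff => _ [_ [_ H]]; rewrite -(H F bF nFL mF w u); last by do !split.
by rewrite (sum_between _ FW aw bw cw).
Qed.

(** If the left boundary carries marked elements, the two sums are tied to different vertices of the
    network, but both equal [lamh M - lamh m]; otherwise this is conservation at [v_F]. *)
Lemma face_balance F m M l r : bounded_face F ->
  face_walks F m M (map inlh l) (map inlh r) -> l != [::] -> r != [::] ->
  \sum_(e <- l) f e = \sum_(e <- r) f e.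
Proof.
move=> bF FW l0 r0; have := fw_l FW; have := fw_r FW; rewrite !bwalk_inl => wr wl.
have nFR : ~ is_FR pos c cL cR F by move=> [_ /(fw_right FW (inr true)) /mapP[]].
case: Ff => _ [H1 [H2 _]].
have [mF|nm] := pselect (left_bd_marked c cL A F); last first.
  by have := H1 F bF nFR nm; rewrite (sum_left _ FW) (sum_right _ FW) => /eqP; rewrite subr_eq0 => /eqP.
have [mm ma MM Ma] := marked_min_max bF FW mF.
have := H2 F bF nFR mF m M mm MM; rewrite (sum_right _ FW) sub0r => /oppr_inj ->.
apply: (@marked_left_sum F m M [::] l [::] m M (map inlh r)) => //=.
by rewrite cats0.
Qed.

Lemma hwalk_refl v s : hwalk v s v -> s = [::].
Proof.
move=> h; apply/eqP/negPn/negP => /(hwalk_lt h); by rewrite /hlt eqxx.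
Qed.

Lemma card_below_lt (u v : hatP P) : hlt u v ->
  (#|[pred z | hlt z u]| < #|[pred z | hlt z v]|)%N.
Proof.
move=> uv; apply: proper_card; apply/properP; split.
  by apply/fintype.subsetP => z; rewrite !inE => /hlt_trans; apply.
by exists u; rewrite !inE ?uv// /hlt eqxx.
Qed.

Lemma path_independence v s s' : hwalk (hbot P) s v -> hwalk (hbot P) s' v ->
  \sum_(e <- s) f e = \sum_(e <- s') f e.
Proof.
have [n] := ubnP #|[pred z | hlt z v]|; elim: n v s s' => // n IH v s s' cn.
have [W WP] := choice (fun v : hatP P => hle_walk (hle_bot v)).
have [vb|vb] := eqVneq v (hbot P).
  by rewrite vb => /hwalk_refl-> /hwalk_refl->.
have {}IH u t t' : hlt u v -> hwalk (hbot P) t u -> hwalk (hbot P) t' u ->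
    \sum_(e <- t) f e = \sum_(e <- t') f e.
  by move=> uv; apply: IH; rewrite -ltnS; apply: leq_trans cn; rewrite ltnS card_below_lt.
(* [val e] is the sum along a chosen walk from 0^ whose last edge is [e]; independence amounts to
   [val] being constant on the incoming edges of [v]. *)
pose val e := \sum_(e' <- W (etail e)) f e' + f e.
have const : forall e e', ehead e = v -> ehead e' = v -> val e = val e'.
  apply: (incoming_constant BD) => F m l r e e' bF FW.
  have [l' lE] : exists l', l = map inlh l'.
    apply: all_inl => b; apply/negP => bl.
    by have := fw_outerl FW (b := b) (k := inl e); rewrite !mem_rcons !inE bl eqxx orbT => /(_ isT isT).
  have [r' rE] : exists r', r = map inlh r'.
    apply: all_inl => b; apply/negP => bl.
    by have := fw_outerr FW (b := b) (k := inl e'); rewrite !mem_rcons !inE bl eqxx orbT => /(_ isT isT).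
  rewrite lE rE -!map_rcons in FW.
  have := fw_l FW; have := fw_r FW; rewrite !bwalk_inl => wr wl.
  have [wl1 ev] := walk_rconsE wl; have [wr1 ev'] := walk_rconsE wr.
  have bal : \sum_(i <- l') f i + f e = \sum_(i <- r') f i + f e'.
    have := face_balance bF FW; rewrite -!cats1 !big_cat !big_seq1 /=; apply.
      by case: (l').
    by case: (r').
  (* By induction the walks to the sources of [e] and [e'] may both be rerouted through the minimum
     [m] of the face, so that the two values differ only along its two sides. *)
  rewrite /val (IH (etail e) _ (W m ++ l')).
  - rewrite (IH (etail e') (W (etail e')) (W m ++ r')).
    + by rewrite !big_cat /= -!addrA; congr (_ + _); exact: bal.
    + by rewrite -ev'; exact: edge_lt.
    + exact: WP.
    + exact: walk_cat (WP m) wr1.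
  - by rewrite -ev; exact: edge_lt.
  - exact: WP.
  - exact: walk_cat (WP m) wl1.
have valE t : hwalk (hbot P) t v -> exists2 e, ehead e = v & \sum_(e <- t) f e = val e.
  case/lastP: t => [/eqP E|t e]; first by rewrite E eqxx in vb.
  move=> /walk_rconsE[tw ev]; exists e => //.
  rewrite -cats1 big_cat big_seq1 /= /val; congr (_ + _); apply: IH tw (WP _).
  by rewrite -ev; exact: edge_lt.
move=> /valE[e ev ->] /valE[e' ev' ->]; exact: const.
Qed.

Lemma flow_preimage : marked_poset A lam ->
  exists2 x, marked_order_polytope A lam x & Gamma A lam x = f.
Proof.
move=> MP; have [W WP] := choice (fun v : hatP P => hle_walk (hle_bot v)).
(* The constant is forced by the convention for the value at 0^. *)
pose X v := lam_min A lam + \sum_(e <- W v) f e.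
have Xf e : X (ehead e) - X (etail e) = f e.
  rewrite /X (path_independence (WP (ehead e)) (s' := rcons (W (etail e)) e)).
    by rewrite -cats1 big_cat big_seq1 /= addrA [_ + f e]addrC addrK.
  by rewrite -cats1; apply: walk_cat (WP _) (walk1 _ _ _).
have Xw u s w : hwalk u s w -> \sum_(e <- s) f e = X w - X u.
  by move=> /(walk_telescope X) <-; apply: eq_bigr => e _; rewrite Xf.
have Xbot : X (hbot P) = lam_min A lam.
  by rewrite /X (hwalk_refl (WP _)) big_nil addr0.
have Xlam v : hmarked A v -> X v = lamh v.
  have [n] := ubnP #|[pred z | hlt z v]|; elim: n v => // n IH v cn va.
  have [->|vb] := eqVneq v (hbot P); first by rewrite Xbot.
  have [e ev] := edge_in vb; have [F [bF eF]] := face_right_of BD e.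
  have [m [M [l [r FW]]]] := bounded_face_walks BD bF.
  have el := (fw_left FW (inl e)).1 eF.
  (* The left side of F_L is the additional edge alone, whereas [e] is on the left side of [F]. *)
  have nFL : ~ is_FL pos c cL cR F.
    by move=> [_ /(fw_left FW (inr false)) h]; have := fw_outerl FW h el.
  have [l' lE] := not_FL_inl bF FW nFL; rewrite lE in FW el.
  have {}el : e \in l' by rewrite -(mem_map inlh_inj).
  have vF : left_bd_elt c cL F v by apply: (left_vertexI FW el); right.
  have mF : left_bd_marked c cL A F by exists v.
  have [_ ma _ _] := marked_min_max bF FW mF.
  have := fw_l FW; rewrite bwalk_inl => wl.
  have [a [b [l'E aw bw]]] := walk_split wl el (or_intror (esym ev)).
  have mv : hlt m v.
    have [h1 _] := hwalk_mem_le wl el; have := edge_lt e; rewrite ev => h2.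
    rewrite /hlt (hle_trans h1 (hlt_le h2)) andbT; apply/eqP => E.
    by move: (hlt_nle h2); rewrite -E h1.
  have : \sum_(e0 <- a) f e0 = lamh v - lamh m.
    rewrite l'E in FW; apply: (@marked_left_sum F m M [::] a b m v r) => //.
    exact: eqxx.
  rewrite (Xw _ _ _ aw).
  rewrite (IH m _ ma); first by move/(congr1 (+%R^~ (lamh m))); rewrite !subrK.
  by rewrite -ltnS; apply: leq_trans cn; rewrite ltnS card_below_lt.
pose x p := X (inr p).
(* At 1^ the left side is [lam_max] by definition; the two agree because 1^ is marked. *)
have xX v : xhat A lam x v = X v.
  by case: v => [[]|p] //=; rewrite ?Xbot// -/(htop P) Xlam.
exists x; last by apply: funext => e; rewrite /Gamma !xX Xf.
split=> [p q pq|a aA]; last by rewrite /x (Xlam (inr a)).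
have [|s sw] := @hle_walk _ P (inr p) (inr q); first exact: ltW.
rewrite -subr_ge0 /x -(Xw _ _ _ sw); apply: sumr_ge0 => e _.
by case: Ff.
Qed.

End Inverse.
End Flow.

Unset Implicit Arguments.

Theorem theorem1p2 (R : realType) (d : Order.disp_t) (P : finPOrderType d)
    (A : {set P}) (lam : P -> R)
    (pos : hatP P -> (R * R)%type) (c : HEdge P -> R -> (R * R)%type) (cL cR : R -> (R * R)%type) :
  marked_poset A lam ->
  (forall a, a \in A -> exists z : int, lam a = z%:~R) ->
  bounded_sp_embedding pos c cL cR A ->
  integrally_equivalent (marked_order_polytope A lam)
    (flow_polytope pos c cL cR A lam) (Gamma A lam).
Proof.
move=> MP lamZ BSP; apply: integrally_equivalent_of_injective.
- exact: Gamma_affine.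
- exact: Gamma_inj.
- by move=> x Ox; exact: (Gamma_flow BSP MP Ox).
- by move=> f Ff; exact: (flow_preimage BSP Ff MP).
- exact: Gamma_int lamZ.
Qed.
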